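(* There is a simple nuclear C*-algebra whose pure state space is not homogeneous and which moreover has a faithful representation on a separable Hilbert space.
   Context: The pure state space of a C*-algebra $A$ is called homogeneous if for every two pure states $\phi$ and $\psi$ of $A$ there is an automorphism $\alpha$ of $A$ such that $\phi\circ\alpha=\psi$. C*-algebras are not assumed to be separable. *)

(* Defs.v *)
From HB Require Import structures.
From mathcomp Require Import all_boot all_order all_algebra.
From mathcomp Require Import complex.
From mathcomp Require Import all_classical all_reals all_analysis.

Set Implicit Arguments.
Unset Strict Implicit.
Unset Printing Implicit Defensive.

Import Order.TTheory GRing.Theory Num.Theory.
Import numFieldNormedType.Exports.

Local Open Scope classical_set_scope.
Local Open Scope ring_scope.
Local Open Scope complex_scope.

(* The scalar field is [R[i]].  Norms of [R[i]]-normed spaces take their values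
   in [R[i]] (in its nonnegative reals); in [R[i]], [0 <= z] means that z is
   real and nonnegative. *)

(* Algebras are not assumed to be unital, so MathComp's rings do not apply. *)
HB.mixin Record Lmodule_isStarAlgebra (R : realType) A
    of GRing.Lmodule R[i] A := {
  smul : A -> A -> A;
  star : A -> A;
  smulA : associative smul;
  smulDl : left_distributive smul +%R;
  smulDr : right_distributive smul +%R;
  smulZl : forall (c : R[i]) (x y : A), smul (c *: x) y = c *: smul x y;
  smulZr : forall (c : R[i]) (x y : A), smul x (c *: y) = c *: smul x y;
  starK : involutive star;
  starD : {morph star : x y / x + y};
  starZ : forall (c : R[i]) (x : A), star (c *: x) = Num.conj c *: star x;
  starM : forall x y : A, star (smul x y) = smul (star y) (star x)
}.

#[short(type="starAlgType")]
HB.structure Definition StarAlgebra (R : realType) :=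
  {A of GRing.Lmodule R[i] A & Lmodule_isStarAlgebra R A}.

HB.mixin Record StarAlgebra_isCstar (R : realType) A
    of StarAlgebra R A & CompleteNormedModule R[i] A := {
  normr_smul : forall x y : A, `|smul x y| <= `|x| * `|y|;
  normr_star_smul : forall x : A, `|smul (star x) x| = `|x| ^+ 2
}.

#[short(type="cstarAlgType")]
HB.structure Definition CstarAlgebra (R : realType) :=
  {A of StarAlgebra R A & CompleteNormedModule R[i] A
      & StarAlgebra_isCstar R A}.

(* The inner product is linear in its first argument; positive definiteness
   follows from [hdotxx]. *)
HB.mixin Record CompleteNormedModule_isHilbert (R : realType) H
    of CompleteNormedModule R[i] H := {
  hdot : H -> H -> R[i];
  hdotDl : forall x y z : H, hdot (x + y) z = hdot x z + hdot y z;
  hdotZl : forall (c : R[i]) (x y : H), hdot (c *: x) y = c * hdot x y;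
  hdotC : forall x y : H, hdot y x = Num.conj (hdot x y);
  hdotxx : forall x : H, hdot x x = `|x| ^+ 2
}.

#[short(type="hilbertType")]
HB.structure Definition Hilbert (R : realType) :=
  {H of CompleteNormedModule R[i] H & CompleteNormedModule_isHilbert R H}.

Definition separable_space (T : topologicalType) : Prop :=
  exists D : set T, countable D /\ dense D.

Definition mxstar (R : realType) (k : nat) (M : 'M[R[i]]_k) : 'M[R[i]]_k :=
  map_mx Num.conj M^T.

Section MatrixStarAlgebra.
Context (R : realType) (k : nat).
Implicit Types (M N : 'M[R[i]]_k) (c : R[i]).

Fact mx_smulZl c M N : (c *: M) *m N = c *: (M *m N).
Proof. by rewrite -scalemxAl. Qed.

Fact mx_smulZr c M N : M *m (c *: N) = c *: (M *m N).
Proof. by rewrite -scalemxAr. Qed.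

Fact mxstarK : involutive (@mxstar R k).
Proof. by move=> M; apply/matrixP => i j; rewrite !mxE conjCK. Qed.

Fact mxstarD : {morph @mxstar R k : M N / M + N}.
Proof. by move=> M N; apply/matrixP => i j; rewrite !mxE rmorphD. Qed.

Fact mxstarZ c M : mxstar (c *: M) = Num.conj c *: mxstar M.
Proof. by apply/matrixP => i j; rewrite !mxE rmorphM. Qed.

Fact mxstarM M N : mxstar (M *m N) = mxstar N *m mxstar M.
Proof. by rewrite /mxstar trmx_mul map_mxM. Qed.

HB.instance Definition _ := Lmodule_isStarAlgebra.Build R 'M[R[i]]_k
  (@mulmxA _ k k k k) (@mulmxDl _ k k k) (@mulmxDr _ k k k)
  mx_smulZl mx_smulZr mxstarK mxstarD mxstarZ mxstarM.

End MatrixStarAlgebra.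

(* [mxopnorm_le M c] : the norm of M as an operator on the Hilbert space C^k is
   at most c. *)
Definition mxopnorm_le (R : realType) (k : nat) (M : 'M[R[i]]_k) (c : R[i])
    : Prop :=
  0 <= c /\ forall v : 'cV[R[i]]_k,
    \sum_i `|(M *m v) i 0| ^+ 2 <= c ^+ 2 * \sum_i `|v i 0| ^+ 2.

(* [mxgram X] is the element X^* X of M_n(A); over a C*-algebra A these are the
   positive elements of M_n(A). *)
Definition mxgram (R : realType) (A : starAlgType R) (n : nat) (X : 'M[A]_n)
    : 'M[A]_n :=
  \matrix_(i, j) \sum_l smul (star (X l i)) (X l j).

Definition completely_positive (R : realType) (A B : starAlgType R)
    (f : A -> B) : Prop :=
  linear f /\
  forall (n : nat) (X : 'M[A]_n), exists Y : 'M[B]_n,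
    map_mx f (mxgram X) = mxgram Y.

(* Nuclearity as in Brown and Ozawa's book: the identity map is a point-norm
   limit of maps that factor, by contractive completely positive maps, through
   full matrix algebras. *)
Definition nuclear (R : realType) (A : cstarAlgType R) : Prop :=
  forall (F : seq A) (e : R), 0 < e ->
    exists (k : nat) (f : A -> 'M[R[i]]_k) (g : 'M[R[i]]_k -> A),
      [/\ completely_positive f /\ (forall a, mxopnorm_le (f a) `|a|),
          completely_positive g /\
            (forall M c, mxopnorm_le M c -> `|g M| <= c)
        & forall a, a \in F -> `|g (f a) - a| < e%:C].

Definition closed_ideal (R : realType) (A : cstarAlgType R) (I : set A)
    : Prop :=
  [/\ I 0,
      forall (c : R[i]) (x y : A), I x -> I y -> I (c *: x + y),
      forall x y : A, I y -> I (smul x y) /\ I (smul y x)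
    & closed I].

Definition simple_cstar (R : realType) (A : cstarAlgType R) : Prop :=
  (exists a : A, a != 0) /\
  forall I : set A, closed_ideal I -> I = [set 0] \/ I = setT.

Definition functional_norm (R : realType) (A : cstarAlgType R)
    (phi : A -> R[i]) (c : R) : Prop :=
  supremums [set r : R | exists2 a : A, `|a| <= 1 & `|phi a| = r%:C] c.

Definition state (R : realType) (A : cstarAlgType R) (phi : A -> R[i])
    : Prop :=
  [/\ scalar phi,
      forall a : A, 0 <= phi (smul (star a) a)
    & functional_norm phi 1].

Definition pure_state (R : realType) (A : cstarAlgType R) (phi : A -> R[i])
    : Prop :=
  state phi /\
  forall (phi1 phi2 : A -> R[i]) (t : R),
    state phi1 -> state phi2 -> 0 < t < 1 ->
    (forall a, phi a = t%:C * phi1 a + (1 - t)%:C * phi2 a) ->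
    phi1 =1 phi /\ phi2 =1 phi.

Definition automorphism (R : realType) (A : cstarAlgType R) (alpha : A -> A)
    : Prop :=
  [/\ linear alpha,
      {morph alpha : x y / smul x y},
      {morph alpha : x / star x}
    & bijective alpha].

Definition homogeneous_pure_states (R : realType) (A : cstarAlgType R)
    : Prop :=
  forall phi psi : A -> R[i], pure_state phi -> pure_state psi ->
    exists2 alpha : A -> A, automorphism alpha & phi \o alpha =1 psi.

Definition representation (R : realType) (A : cstarAlgType R)
    (H : hilbertType R) (pi : A -> H -> H) : Prop :=
  [/\ forall a, linear (pi a) /\ continuous (pi a),
      forall (c : R[i]) (a b : A) (x : H),
        pi (c *: a + b) x = c *: pi a x + pi b x,
      forall (a b : A) (x : H), pi (smul a b) x = pi a (pi b x)
    & forall (a : A) (x y : H), hdot (pi a x) y = hdot x (pi (star a) y)].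

Definition faithful_representation (R : realType) (A : cstarAlgType R)
    (H : hilbertType R) (pi : A -> H -> H) : Prop :=
  representation pi /\ injective pi.

(* Main.v *)
(** The algebra is generated, on l2(G) for the countable group
    [G = F_2 (+) F_2 (+) ...] of polynomials over [F_2], by the translations and
    by the multiplications with all the characters of [G].  Every splitting of
    [G] into a finite subgroup [U] and a complement of it identifies l2(G) with
    l2(U) (x) l2(G / U), hence yields a copy of the full matrix algebra over
    [U].  These copies form a directed family with dense union, so that the
    algebra is simple and nuclear, and a state which is a vector state on each
    of them is pure.  Two such states are the vector state at the point mass
    at [0], whose GNS space is the separable space l2(G), and the state that
    extends the invariant mean.  For the latter the characters of [G] are
    orthonormal, and there are uncountably many of them: no automorphism can
    map one state to the other.  (Bipartite case of Farah's graph CCR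
    algebras.) *)
Require Import Defs.
From HB Require Import structures.
From mathcomp Require Import all_boot all_order all_algebra.
From mathcomp Require Import complex ring lra.
From mathcomp Require Import all_classical all_reals all_analysis.

Set Implicit Arguments.
Unset Strict Implicit.
Unset Printing Implicit Defensive.

Import Order.TTheory GRing.Theory Num.Theory.
Import numFieldNormedType.Exports.

Local Open Scope classical_set_scope.
Local Open Scope ring_scope.
Local Open Scope complex_scope.

Local Notation Re := complex.Re.
Local Notation Im := complex.Im.

(** * Square-summable functions *)

(** The obstacle is to keep the Hilbert space separable while fitting in uncountably many
    characters. The room for them is in the choice of the complement: [G] has only countably many
    finite subgroups, but a complement is the common kernel of finitely many arbitrary linear
    functionals on [G]. Enlarging the subgroup captures more translations, shrinking the complement
    captures more characters, and over a field both are done by elimination, one vector or one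
    functional at a time; this gives directedness. The algebra is the norm closure of the block
    operators on l2(G) itself, so the separable faithful representation is there by construction.
    For every splitting the point mass, and the indicator of a large enough [Fn n], are product
    vectors; each yields a projection, of rank one in the finite factor, that compresses every block
    to a scalar, and this is why the two states are pure. The GNS space of the mean is never built:
    an automorphism would send the characters to vectors of l2(G) with the same mutual distances. *)

Definition G : Type := {poly 'F_2}.
HB.instance Definition _ := GRing.Zmodule.on G.
HB.instance Definition _ := Countable.on G.

(* The finite subgroups [Fn n] exhaust [G]; sums over [G] are taken as limits
   along them. *)
Definition Fn (n : nat) : seq G := [seq rVpoly v | v <- enum {:'rV['F_2]_n}].

Lemma mem_Fn n (p : G) : (p \in Fn n) = (size (p : {poly 'F_2}) <= n)%N.
Proof.
apply/mapP/idP => [[v _ ->]|sp]; first exact: size_poly.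
by exists (poly_rV p); rewrite ?mem_enum// poly_rV_K.
Qed.

Lemma Fn_uniq n : uniq (Fn n).
Proof. by rewrite map_inj_uniq ?enum_uniq//; exact: can_inj (@rVpolyK _ _). Qed.

Lemma Fn_shift n (w : G) : (size (w : {poly 'F_2}) <= n)%N ->
  perm_eq [seq p + w | p <- Fn n] (Fn n).
Proof.
move=> sw; apply: uniq_perm; rewrite ?Fn_uniq//.
  by rewrite map_inj_uniq ?Fn_uniq//; exact: addIr.
have memD (p q : G) : p \in Fn n -> q \in Fn n -> p + q \in Fn n.
  rewrite !mem_Fn => sp sq.
  by rewrite (leq_trans (size_polyD _ _))// geq_max sp sq.
have wF : w \in Fn n by rewrite mem_Fn.
move=> p; apply/mapP/idP => [[q qF ->]|pF]; first exact: memD.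
exists (p - w); last by rewrite subrK.
by apply: memD => //; rewrite mem_Fn size_polyN.
Qed.

Lemma Fn_le n m : (n <= m)%N ->
  perm_eq [seq p <- Fn m | p \in Fn n] (Fn n).
Proof.
move=> nm; apply: uniq_perm; rewrite ?filter_uniq ?Fn_uniq// => p.
rewrite mem_filter; case: (boolP (p \in Fn n)) => //=; rewrite !mem_Fn => pn.
exact: leq_trans nm.
Qed.

Lemma sumFn_shift (V : nmodType) n (w : G) (h : G -> V) :
  (size (w : {poly 'F_2}) <= n)%N ->
  \sum_(p <- Fn n) h (p + w) = \sum_(p <- Fn n) h p.
Proof.
move=> sw; rewrite -[RHS](perm_big _ (Fn_shift sw))
  (big_map (fun p : G => p + w)).
by [].
Qed.

Lemma sumFn_sub (V : nmodType) n m (h : G -> V) : (n <= m)%N ->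
  \sum_(p <- Fn m | p \in Fn n) h p = \sum_(p <- Fn n) h p.
Proof. by move=> nm; rewrite -big_filter (perm_big _ (Fn_le nm)). Qed.

Lemma sumFn_le (R : numDomainType) n m (h : G -> R) : (forall p, 0 <= h p) ->
  (n <= m)%N -> \sum_(p <- Fn n) h p <= \sum_(p <- Fn m) h p.
Proof.
move=> h0 nm; rewrite -(sumFn_sub _ nm) [leRHS](bigID (mem (Fn n)))/=.
by rewrite lerDl sumr_ge0.
Qed.

(** * Complex scalars and their limits, through real and imaginary parts *)

Section Complex.
Context {R : realType}.
Local Notation C := R[i].
Implicit Types z w : C.

(** The norm on [R[i]] is itself complex-valued, whereas suprema, square roots and monotone limits
    are taken in [R]; hence a real squared modulus. *)
Definition nsq z : R := Re z ^+ 2 + Im z ^+ 2.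

Lemma ReD z w : Re (z + w) = Re z + Re w. Proof. by case: z; case: w. Qed.
Lemma ImD z w : Im (z + w) = Im z + Im w. Proof. by case: z; case: w. Qed.
Lemma ReN z : Re (- z) = - Re z. Proof. by case: z. Qed.
Lemma ImN z : Im (- z) = - Im z. Proof. by case: z. Qed.
Lemma ReM z w : Re (z * w) = Re z * Re w - Im z * Im w.
Proof. by case: z; case: w. Qed.
Lemma ImM z w : Im (z * w) = Re z * Im w + Im z * Re w.
Proof. by case: z; case: w. Qed.
Lemma ReC (x : R) : Re x%:C = x. Proof. by []. Qed.
Lemma ImC (x : R) : Im x%:C = 0. Proof. by []. Qed.
Lemma Reconj z : Re (Num.conj z) = Re z. Proof. by case: z. Qed.
Lemma Imconj z : Im (Num.conj z) = - Im z. Proof. by case: z. Qed.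
Definition CE := (ReD, ImD, ReN, ImN, ReM, ImM, ReC, ImC, Reconj, Imconj).

Lemma complex_ext z w : Re z = Re w -> Im z = Im w -> z = w.
Proof. by case: z w => a b [c d] /= -> ->. Qed.

Lemma Re_sum (I : Type) (r : seq I) (P : pred I) (f : I -> C) :
  Re (\sum_(i <- r | P i) f i) = \sum_(i <- r | P i) Re (f i).
Proof. by apply: (big_morph _ ReD). Qed.
Lemma Im_sum (I : Type) (r : seq I) (P : pred I) (f : I -> C) :
  Im (\sum_(i <- r | P i) f i) = \sum_(i <- r | P i) Im (f i).
Proof. by apply: (big_morph _ ImD). Qed.

Lemma nsq_ge0 z : 0 <= nsq z. Proof. by rewrite addr_ge0 ?sqr_ge0. Qed.
Lemma nsqM z w : nsq (z * w) = nsq z * nsq w.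
Proof. by rewrite /nsq !CE; ring. Qed.
Lemma nsqN z : nsq (- z) = nsq z.
Proof. by rewrite /nsq !CE; ring. Qed.
Lemma nsq0 : nsq 0 = 0. Proof. by rewrite /nsq/=; ring. Qed.
Lemma nsq_eq0 z : nsq z = 0 -> z = 0.
Proof.
move=> /eqP; rewrite /nsq paddr_eq0 ?sqr_ge0// !sqrf_eq0 =>
  /andP[/eqP a /eqP b].
exact: complex_ext.
Qed.
Lemma nsqE z : (nsq z)%:C = `|z| ^+ 2.
Proof. by rewrite -add_Re2_Im2. Qed.
Lemma normE z : `|z| = (Num.sqrt (nsq z))%:C.
Proof. by rewrite normc_def. Qed.
Lemma nsqC (x : R) : nsq x%:C = x ^+ 2.
Proof. by rewrite /nsq/=; ring. Qed.
Lemma mulconj z : z * Num.conj z = (nsq z)%:C.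
Proof. by apply: complex_ext; rewrite !CE /nsq; ring. Qed.

(** The difference of the two sides is a multiple of $|tz - w|^2$. The free weight [t] lets the
    triangle inequality of l2 be proved term by term. *)
Lemma nsqD_le (t : R) z w : 0 < t ->
  nsq (z + w) <= (1 + t) * nsq z + (1 + t^-1) * nsq w.
Proof.
move=> t0; rewrite -subr_ge0.
have -> : (1 + t) * nsq z + (1 + t^-1) * nsq w - nsq (z + w) =
    t^-1 * nsq (t%:C * z - w).
  by rewrite /nsq !CE; field; rewrite gt_eqF.
by rewrite mulr_ge0 ?nsq_ge0// invr_ge0 ltW.
Qed.

Lemma nsqD z w : nsq (z + w) = nsq z + nsq w + 2 * Re (z * Num.conj w).
Proof. by rewrite /nsq !CE; ring. Qed.

(* Minkowski, through [nsqD_le] with [t = b / a]. *)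
Lemma sum_nsqD_le (I : Type) (r : seq I) (f g : I -> C) (a b : R) :
  0 <= a -> 0 <= b ->
  \sum_(i <- r) nsq (f i) <= a ^+ 2 -> \sum_(i <- r) nsq (g i) <= b ^+ 2 ->
  \sum_(i <- r) nsq (f i + g i) <= (a + b) ^+ 2.
Proof.
move=> a0 b0 fa gb.
(* Strictly larger bounds make the weight [b' / a'] positive even if [a] or [b] vanishes; they are
   then let tend to [a] and [b]. *)
suff H (a' b' : R) : a < a' -> b < b' ->
    \sum_(i <- r) nsq (f i + g i) <= (a' + b') ^+ 2.
  have s0 : 0 <= \sum_(i <- r) nsq (f i + g i).
    by apply: sumr_ge0 => i _; exact: nsq_ge0.
  rewrite -(sqr_sqrtr s0) ler_pXn2r ?nnegrE ?sqrtr_ge0 ?addr_ge0//.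
  apply/ler_addgt0Pr => e e0.
  have := H (a + e / 2) (b + e / 2); rewrite !ltrDl !divr_gt0// => /(_ isT isT).
  have -> : a + e / 2 + (b + e / 2) = a + b + e by field.
  move=> h; rewrite -(ler_pXn2r (_ : 0 < 2)%N) ?nnegrE ?sqrtr_ge0//.
    by rewrite sqr_sqrtr.
  by rewrite !addr_ge0// ltW.
move=> aa' bb'; have a'0 := le_lt_trans a0 aa'; have b'0 := le_lt_trans b0 bb'.
have t0 : 0 < b' / a' by rewrite divr_gt0.
apply: (@le_trans _ _ (\sum_(i <- r) ((1 + b' / a') * nsq (f i) +
    (1 + (b' / a')^-1) * nsq (g i)))).
  by apply: ler_sum => i _; exact: nsqD_le.
rewrite big_split/= -!mulr_sumr.
have -> : (a' + b') ^+ 2 =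
  (1 + b' / a') * a' ^+ 2 + (1 + (b' / a')^-1) * b' ^+ 2.
  by field; rewrite !gt_eqF.
apply: lerD; rewrite ler_pM2l ?addr_gt0 ?invr_gt0//.
  by apply: (le_trans fa); rewrite ler_pXn2r ?nnegrE// ltW.
by apply: (le_trans gb); rewrite ler_pXn2r ?nnegrE// ltW.
Qed.

Definition clim (u : nat -> C) z :=
  Re (u n) @[n --> \oo] --> Re z /\ Im (u n) @[n --> \oo] --> Im z.

Lemma clim_unique u z w : clim u z -> clim u w -> z = w.
Proof.
move=> [a b] [c d]; apply: complex_ext.
  exact: (cvg_unique _ a c).
exact: (cvg_unique _ b d).
Qed.

Lemma climD u v z w : clim u z -> clim v w -> clim (fun n => u n + v n) (z + w).
Proof.
move=> [a b] [c d]; split.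
  rewrite ReD; under eq_fun do rewrite ReD; exact: cvgD.
by rewrite ImD; under eq_fun do rewrite ImD; exact: cvgD.
Qed.

Lemma climM c u z : clim u z -> clim (fun n => c * u n) (c * z).
Proof.
move=> [a b]; split.
  rewrite ReM; under eq_fun do rewrite ReM.
  by apply: (@cvgB _ _ _ _ _ (fun n => Re c * Re (u n))); apply: cvgMl_tmp.
rewrite ImM; under eq_fun do rewrite ImM.
by apply: (@cvgD _ _ _ _ _ (fun n => Re c * Im (u n))); apply: cvgMl_tmp.
Qed.

Lemma clim_conj u z : clim u z -> clim (fun n => Num.conj (u n)) (Num.conj z).
Proof.
move=> [a b]; split.
  by rewrite Reconj; under eq_fun do rewrite Reconj.
by rewrite Imconj; under eq_fun do rewrite Imconj;
  exact: (@cvgN _ _ _ _ _ (fun n => Im (u n))).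
Qed.

Lemma clim_eventually u z N : (forall n, (N <= n)%N -> u n = z) -> clim u z.
Proof.
move=> h; split; apply: cvg_near_cst; exists N => // n /= Nn; rewrite h//.
Qed.

End Complex.

Section Complete.
Context {R : realType} (V : normedModType R[i]).

Lemma gt0_complexE (e : R[i]) : 0 < e -> exists2 r : R, 0 < r & e = r%:C.
Proof.
case: e => a b; rewrite ltcE/= => /andP[/eqP -> a0].
by exists a.
Qed.

(** Serves both for l2 and for the algebra, where the candidate limit is built coordinatewise or
    pointwise and only closed-ball estimates survive the passage to the limit. *)
Lemma cauchy_limit (F : set_system V) (FF : ProperFilter F) (l : V) :
  cauchy F ->
  (forall x (e : R), 0 < e -> F (ball x e%:C) -> `|x - l| <= e%:C) ->
  F --> l.
Proof.
move=> /cauchyP Fc Fl; apply/fcvgrPdist_lt => _ /gt0_complexE[e e0 ->].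
have e30 : 0 < e / 3 by rewrite divr_gt0.
have [|x Fx] := Fc (e / 3)%:C; first by rewrite ltcR.
have xl := Fl _ _ e30 Fx; apply: filterS Fx => y; rewrite -ball_normE/= => xy.
rewrite -(subrK x l) -addrA (le_lt_trans (ler_normD _ _))//.
have -> : e%:C = (e / 3)%:C + (e * (2 / 3))%:C :> R[i].
  by rewrite -rmorphD/=; congr (_%:C); field.
rewrite distrC; apply: ler_ltD => //; apply: (lt_trans xy); rewrite ltcR.
by rewrite ltr_pM2l//; lra.
Qed.
End Complete.

Section Ell2.
Context (R : realType).
Local Notation C := R[i].
Implicit Types f g : G -> C.

Definition part n f : R := \sum_(p <- Fn n) nsq (f p).

Definition l2pred : {pred G -> C} :=
  fun f => `[< exists c : R, forall n, part n f <= c >].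

Lemma part_ge0 n f : 0 <= part n f.
Proof. by apply: sumr_ge0 => p _; exact: nsq_ge0. Qed.

Lemma part_le f n m : (n <= m)%N -> part n f <= part m f.
Proof. by apply: sumFn_le => p; exact: nsq_ge0. Qed.

Lemma partZ n c f : part n (c *: f) = nsq c * part n f.
Proof. by rewrite mulr_sumr; apply: eq_bigr => p _; rewrite -nsqM. Qed.

Lemma part_nsq n f p : p \in Fn n -> nsq (f p) <= part n f.
Proof.
move=> pF; rewrite /part (big_rem p)//= lerDl.
by apply: sumr_ge0 => q _; exact: nsq_ge0.
Qed.

Lemma partD n f g (a b : R) : 0 <= a -> 0 <= b ->
  part n f <= a ^+ 2 -> part n g <= b ^+ 2 -> part n (f + g) <= (a + b) ^+ 2.
Proof. exact: sum_nsqD_le. Qed.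

Lemma l2predP f : reflect (exists2 c : R, 0 <= c & forall n, part n f <= c ^+ 2)
  (f \in l2pred).
Proof.
apply: (iffP (asboolP _)) => [[c cf]|[c _ cf]]; last by exists (c ^+ 2).
exists (Num.sqrt c); first exact: sqrtr_ge0.
by move=> n; rewrite sqr_sqrtr//; apply: le_trans (cf 0%N); exact: part_ge0.
Qed.

Lemma l2pred_submod : submod_closed l2pred.
Proof.
split=> [|c f g].
  apply/l2predP; exists 0 => // n; rewrite expr0n/=.
  by rewrite /part big1// => p _; rewrite nsq0.
move=> /l2predP[a a0 af] /l2predP[b b0 bg]; apply/l2predP.
exists (Num.sqrt (nsq c) * a + b).
  by rewrite addr_ge0// mulr_ge0// sqrtr_ge0.
move=> n; apply: partD => //; first by rewrite mulr_ge0// sqrtr_ge0.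
rewrite partZ exprMn sqr_sqrtr ?nsq_ge0//.
by rewrite ler_wpM2l ?nsq_ge0.
Qed.

HB.instance Definition _ := GRing.isSubmodClosed.Build C (G -> C) l2pred
  l2pred_submod.

Record l2 := L2 { l2f :> G -> C; l2fP : l2f \in l2pred }.
HB.instance Definition _ := [isSub of l2 for l2f].
HB.instance Definition _ := [Choice of l2 by <:].
HB.instance Definition _ := [SubChoice_isSubLmodule of l2 by <:].

Implicit Types x y z : l2.

Lemma l2_ext x y : (forall p, x p = y p) -> x = y.
Proof. by move=> xy; apply: val_inj; apply/funext => p; exact: xy. Qed.
Lemma l2D x y p : (x + y) p = x p + y p. Proof. by []. Qed.
Lemma l2B x y p : (x - y) p = x p - y p. Proof. by []. Qed.
Lemma l2Z c x p : (c *: x) p = c * x p. Proof. by []. Qed.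
Definition hn2 x : R := sup (range (fun n => part n x)).
Definition hn x : R := Num.sqrt (hn2 x).

Lemma part_cvg x : part n x @[n --> \oo] --> hn2 x.
Proof.
apply: nondecreasing_cvgn; first by move=> n m; exact: part_le.
have /l2predP[c _ cx] := l2fP x.
by exists (c ^+ 2) => _ [n _ <-].
Qed.
Arguments part_cvg : clear implicits.

Lemma hn2_ge0 x : 0 <= hn2 x.
Proof.
by apply: (cvgr_to_ge (part_cvg x)); apply: nearW => n; exact: part_ge0.
Qed.

Lemma hn_ge0 x : 0 <= hn x. Proof. exact: sqrtr_ge0. Qed.

Lemma hn_sqr x : hn x ^+ 2 = hn2 x. Proof. by rewrite sqr_sqrtr ?hn2_ge0. Qed.

Lemma part_le_hn x n : part n x <= hn x ^+ 2.
Proof.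
rewrite hn_sqr; apply: (cvgr_to_ge (part_cvg x)).
by exists n => // m nm; exact: part_le.
Qed.

Lemma hn_le x c : 0 <= c -> (forall n, part n x <= c ^+ 2) -> hn x <= c.
Proof.
move=> c0 xc; rewrite -(ler_pXn2r (_ : 0 < 2)%N) ?nnegrE ?hn_ge0//.
by rewrite hn_sqr; apply: (cvgr_to_le (part_cvg x)); apply: nearW => n;
  exact: xc.
Qed.

Lemma nsq_le_hn x p : nsq (x p) <= hn x ^+ 2.
Proof.
apply: le_trans (part_le_hn x (size (p : {poly 'F_2}))).
by apply: part_nsq; rewrite mem_Fn.
Qed.

Lemma hn_eq0 x : hn x = 0 -> x = 0.
Proof.
move=> x0; apply: l2_ext => p; apply: nsq_eq0; apply/eqP.
by rewrite eq_le nsq_ge0 andbT (le_trans (nsq_le_hn x p))// x0 expr0n.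
Qed.

Lemma hnD x y : hn (x + y) <= hn x + hn y.
Proof.
apply: hn_le; first by rewrite addr_ge0 ?hn_ge0.
by move=> n; apply: partD; rewrite ?hn_ge0// part_le_hn.
Qed.

Lemma hn2Z c x : hn2 (c *: x) = nsq c * hn2 x.
Proof.
apply: (cvg_unique _ (part_cvg _)) => //.
rewrite (_ : (fun n => _) = (fun n => nsq c * part n x)).
  by apply: cvgMl_tmp; exact: part_cvg.
by apply/funext => n; exact: partZ.
Qed.

Lemma hnZ c x : hn (c *: x) = Num.sqrt (nsq c) * hn x.
Proof. by rewrite /hn hn2Z sqrtrM ?nsq_ge0. Qed.

Fact l2_normD x y : (hn (x + y))%:C <= (hn x)%:C + (hn y)%:C :> C.
Proof. by rewrite -rmorphD lecR hnD. Qed.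
Fact l2_normZ c x : (hn (c *: x))%:C = `|c| * (hn x)%:C.
Proof. by rewrite hnZ rmorphM normE. Qed.
Fact l2_norm0 x : (hn x)%:C = 0 :> C -> x = 0.
Proof. by move=> /complexI; exact: hn_eq0. Qed.

HB.instance Definition _ := Lmodule_isNormed.Build C l2
  l2_normD l2_normZ l2_norm0.

Lemma l2normE x : `|x| = (hn x)%:C. Proof. by []. Qed.

Lemma l2_complete (F : set_system l2) : ProperFilter F -> cauchy F -> cvg F.
Proof.
move=> FF Fc.
have Fex : forall e : R, 0 < e -> exists x, F [set y | hn (x - y) < e].
  move=> e e0; have /cauchyP/(_ e%:C)[|x Fx] := Fc; first by rewrite ltcR.
  by exists x; apply: filterS Fx => y; rewrite -ball_normE/= l2normE ltcR.
(* [h] stands for [Re] or [Im]; each coordinate is dominated by the norm, so it is Cauchy along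
   [F]. *)
have coord (h : C -> R) : (forall u v : C, h (u - v) = h u - h v) ->
    (forall u : C, h u ^+ 2 <= nsq u) -> forall p,
    exists l : R, h ((y : l2) p) @[y --> F] --> l.
  move=> hB hle p.
  suff : cvg (h ((y : l2) p) @[y --> F]) by move=> /cvg_ex.
  apply: R_complete; apply/cauchyP => e e0.
  have [x Fx] := Fex e e0; exists (h (x p)).
  change (F [set y : l2 | ball (h (x p)) e (h (y p))]).
  apply: filterS Fx => y /= xy; rewrite -ball_normE/= -hB.
  apply: le_lt_trans xy; rewrite -(ler_pXn2r (_ : 0 < 2)%N) ?nnegrE ?hn_ge0//.
  by rewrite -normrX ger0_norm ?sqr_ge0// (le_trans (hle _))// -l2B nsq_le_hn.
have /choice[lr lrP] := coord (@Re R)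
  ltac:(by move=> z w; rewrite !CE) ltac:(by move=> z; rewrite lerDl sqr_ge0).
have /choice[li liP] := coord (@Im R)
  ltac:(by move=> z w; rewrite !CE) ltac:(by move=> z; rewrite lerDr sqr_ge0).
pose l p : C := lr p +i* li p.
have lP x (e : R) : 0 < e -> F [set y | hn (x - y) < e] ->
    forall n, part n ((x : G -> C) - l) <= e ^+ 2.
  move=> e0 Fx n.
  have cv : part n (x - y : l2) @[y --> F] --> part n ((x : G -> C) - l).
    apply: (@cvg_big R G +%R 0 xpredT (@add_continuous _) l2 F (Fn n)
      (fun p (y : l2) => nsq (x p - y p)) (fun p => nsq (x p - l p))) => p _.
    rewrite /nsq; under eq_fun do rewrite !CE; rewrite !CE.
    apply: (@cvgD _ _ _ _ _ (fun y : l2 => (Re (x p) - Re (y p)) ^+ 2)).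
      by apply: cvgM; apply: cvgB; (try exact: cvg_cst); exact: lrP.
    by apply: cvgM; apply: cvgB; (try exact: cvg_cst); exact: liP.
  apply: (cvgr_to_le cv); apply: filterS Fx => y xy.
  apply: le_trans (part_le_hn (x - y) n) _.
  by rewrite ler_pXn2r ?nnegrE ?hn_ge0 ?(ltW e0)// ltW.
have l2l : l \in l2pred.
  have [x Fx] := Fex 1 ltr01.
  have h := lP _ _ ltr01 Fx.
  (* The limit is square-summable as the difference of [x] and of [x - l], whose partial sums are
     bounded by 1. *)
  have -> : l = (x : G -> C) - ((x : G -> C) - l) by rewrite opprB addrC subrK.
  apply: rpredB; first exact: l2fP.
  by apply/l2predP; exists 1.
apply/cvg_ex; exists (L2 l2l); apply: cauchy_limit => // x e e0 Fx.
rewrite l2normE lecR; apply: hn_le; first exact: ltW.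
apply: lP => //; apply: filterS Fx => y.
by rewrite -ball_normE/= l2normE ltcR.
Qed.

HB.instance Definition _ := Uniform_isComplete.Build l2 l2_complete.

(* Polarization: existence of the series in [l2dot_lim] then comes for free from
   the monotone convergence of [part]. *)
Definition l2dot x y : C :=
  ((hn2 (x + y) - hn2 x - hn2 y) / 2) +i*
  ((hn2 (x + 'i *: y) - hn2 x - hn2 ('i *: y)) / 2).

Lemma l2dot_lim x y :
  clim (fun n => \sum_(p <- Fn n) x p * Num.conj (y p)) (l2dot x y).
Proof.
have re (u v : l2) : (fun n => \sum_(p <- Fn n) Re (u p * Num.conj (v p))) =
    (fun n => (part n (u + v : l2) - part n u - part n v) / 2).
  apply/funext => n; rewrite /part -!sumrB mulr_suml; apply: eq_bigr => p _.
  by rewrite l2D nsqD; field.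
have reL (u v : l2) :
  \sum_(p <- Fn n) Re (u p * Num.conj (v p)) @[n --> \oo] -->
    (hn2 (u + v) - hn2 u - hn2 v) / 2.
  rewrite re; apply: cvgMr_tmp; apply: cvgB; last exact: part_cvg.
  by apply: cvgB; exact: part_cvg.
split; first by under eq_fun do rewrite Re_sum; exact: reL.
under eq_fun do rewrite Im_sum.
(* The imaginary part of $x\bar y$ is the real part of $x\,\overline{iy}$, so the real case
   applies. *)
have -> : (fun n => \sum_(p <- Fn n) Im (x p * Num.conj (y p))) =
   (fun n => \sum_(p <- Fn n) Re (x p * Num.conj (('i *: y : l2) p))).
  apply/funext => n; apply: eq_bigr => p _; rewrite l2Z !CE /= !mul0r !mul1r;
    ring.
exact: reL.
Qed.

Fact l2dotDl x y z : l2dot (x + y) z = l2dot x z + l2dot y z.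
Proof.
apply: clim_unique (l2dot_lim _ _) _.
under eq_fun do under eq_bigr do rewrite l2D mulrDl.
under eq_fun do rewrite big_split/=.
by apply: climD; exact: l2dot_lim.
Qed.

Fact l2dotZl c x y : l2dot (c *: x) y = c * l2dot x y.
Proof.
apply: clim_unique (l2dot_lim _ _) _.
under eq_fun do under eq_bigr do rewrite l2Z -mulrA.
under eq_fun do rewrite -mulr_sumr.
by apply: climM; exact: l2dot_lim.
Qed.

Fact l2dotC x y : l2dot y x = Num.conj (l2dot x y).
Proof.
apply: clim_unique (l2dot_lim _ _) _.
rewrite (_ : (fun n => _) =
  (fun n => Num.conj (\sum_(p <- Fn n) x p * Num.conj (y p)))).
  by apply: clim_conj; exact: l2dot_lim.
apply/funext => n; rewrite rmorph_sum; apply: eq_bigr => p _.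
by apply: complex_ext; rewrite !CE; ring.
Qed.

Fact l2dotxx x : l2dot x x = `|x| ^+ 2.
Proof.
apply: clim_unique (l2dot_lim _ _) _; rewrite l2normE -rmorphXn hn_sqr.
under eq_fun do under eq_bigr do rewrite mulconj.
split.
  under eq_fun do rewrite Re_sum; exact: part_cvg.
under eq_fun do rewrite Im_sum big1//.
exact: cvg_cst.
Qed.

HB.instance Definition _ := CompleteNormedModule_isHilbert.Build R l2
  l2dotDl l2dotZl l2dotC l2dotxx.

End Ell2.
Arguments part_cvg {R} x.

Lemma addf0 (U V : zmodType) (f : U -> V) : {morph f : x y / x + y} -> f 0 = 0.
Proof. by move=> fD; apply: (addrI (f 0)); rewrite -fD !addr0. Qed.

Lemma addfN (U V : zmodType) (f : U -> V) : {morph f : x y / x + y} ->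
  {morph f : x / - x}.
Proof.
by move=> fD x; apply: (addrI (f x)); rewrite -fD !subrr (addf0 fD).
Qed.

Lemma addfB (U V : zmodType) (f : U -> V) : {morph f : x y / x + y} ->
  {morph f : x y / x - y}.
Proof. by move=> fD x y; rewrite fD (addfN fD). Qed.

(** * Local matrix algebras *)

(* [G] is the direct sum of [iota U] and of the kernel of [rho]. *)
Record splitting := Splitting {
  split_group :> finZmodType;
  rho : G -> split_group;
  iota : split_group -> G;
  rhoD : {morph rho : x y / x + y};
  iotaD : {morph iota : x y / x + y};
  rhoK : cancel iota rho
}.

Arguments rho {s} _.
Arguments iota {s} _.

Section Splitting.
Variable S : splitting.

Implicit Types (s t : S) (y : G).

(* The point of the coset [y + iota U] whose component in [U] is [t]. *)
Definition mv t y : G := y + iota (t - rho y).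

Lemma rho_mv t y : rho (mv t y) = t.
Proof. by rewrite /mv rhoD rhoK addrC subrK. Qed.

Lemma mv_mv s t y : mv s (mv t y) = mv s y.
Proof.
rewrite {1}/mv rho_mv /mv -addrA -iotaD; congr (_ + iota _).
by rewrite addrC addrA subrK.
Qed.

Lemma mv_rho y : mv (rho y) y = y.
Proof. by rewrite /mv subrr (addf0 (@iotaD S)) addr0. Qed.

Lemma mv_iota s t : mv s (iota t) = iota s.
Proof. by rewrite /mv rhoK -iotaD addrC subrK. Qed.

Definition split_size : nat := \max_(t : S) size (iota t : {poly 'F_2}).

Lemma size_iota t : (size (iota t : {poly 'F_2}) <= split_size)%N.
Proof. exact: (leq_bigmax t). Qed.

(** For such [n], translation by each [iota t] permutes [Fn n]. Summing over whole cosets at every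
    point, at the price of the factor [#|S|], avoids a choice of coset representatives. *)
Lemma sum_mv (V : nmodType) n (h : G -> V) : (split_size <= n)%N ->
  \sum_(y <- Fn n) \sum_(t : S) h (mv t y) = (\sum_(y <- Fn n) h y) *+ #|S|.
Proof.
move=> Sn.
have -> : \sum_(y <- Fn n) \sum_(t : S) h (mv t y) =
    \sum_(y <- Fn n) \sum_(t : S) h (y + iota t).
  apply: eq_bigr => y _.
  rewrite (reindex_inj (addIr (rho y))); apply: eq_bigr => t _.
  by rewrite /mv addrK.
rewrite exchange_big/= (eq_bigr (fun _ => \sum_(y <- Fn n) h y)).
  by rewrite sumr_const.
by move=> t _; rewrite sumFn_shift// (leq_trans (size_iota t)).
Qed.

End Splitting.

Section Gm.
Context {R : realType}.
Local Notation C := R[i].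
Local Notation l2 := (l2 R).

Definition mmul (U : finType) (m n : U -> U -> C) s t := \sum_u m s u * n u t.
Definition madj (U : finType) (m : U -> U -> C) s t := Num.conj (m t s).
Definition mone (U : finType) (s t : U) : C := (s == t)%:R.
Definition mbound (U : finType) (m : U -> U -> C) (c : R) :=
  0 <= c /\ forall v : U -> C,
    \sum_s nsq (\sum_t m s t * v t) <= c ^+ 2 * \sum_t nsq (v t).

Lemma mbound_ex (U : finType) (m : U -> U -> C) : exists c, mbound m c.
Proof.
pose ab (z : C) := Num.sqrt (nsq z).
have abE z : `|z| = (ab z)%:C by rewrite normE.
pose d s := \sum_t ab (m s t).
have d0 s : 0 <= d s by apply: sumr_ge0 => t _; exact: sqrtr_ge0.
(* A crude bound is enough: a coordinate of the image is at most the l1 norm [d s] of its row times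
   the norm of [v]. *)
exists (Num.sqrt (\sum_s d s ^+ 2)); split; first exact: sqrtr_ge0.
move=> v; set M := \sum_t nsq (v t).
have M0 : 0 <= M by apply: sumr_ge0 => t _; exact: nsq_ge0.
rewrite sqr_sqrtr; last by apply: sumr_ge0 => t _; exact: sqr_ge0.
rewrite mulr_suml; apply: ler_sum => s _.
have : ab (\sum_t m s t * v t) <= d s * Num.sqrt M.
  rewrite -lecR -abE (le_trans (ler_norm_sum _ _ _))//.
  rewrite /d mulr_suml rmorph_sum/=; apply: ler_sum => t _.
  rewrite normrM !abE -rmorphM lecR ler_wpM2l ?sqrtr_ge0// ler_wsqrtr//.
  by rewrite /M (bigD1 t)//= lerDl sumr_ge0// => u _; exact: nsq_ge0.
move=> /(lerXn2r 2); rewrite !nnegrE exprMn !sqr_sqrtr ?nsq_ge0//.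
by apply; rewrite ?mulr_ge0 ?sqrtr_ge0.
Qed.

Variable S : splitting.
Implicit Types (m : S -> S -> C) (f : G -> C) (x y : l2).

(* The matrix [m] acting on the first factor of l2(U) (x) l2(ker rho). *)
Definition block_fun m f : G -> C := fun p => \sum_t m (rho p) t * f (mv t p).

Lemma block_fun_mv m f s p : block_fun m f (mv s p) = \sum_t m s t * f (mv t p).
Proof.
by rewrite /block_fun rho_mv; apply: eq_bigr => t _; rewrite mv_mv.
Qed.

Lemma card_gt0 : (0 < #|S|)%N.
Proof. by rewrite (cardD1 (0 : S)). Qed.

(** After multiplication by [#|S|] both sides become sums over cosets, and on a single coset the
    claim is the bound on the matrix. *)
Lemma block_fun_part m f c n : mbound m c -> (split_size S <= n)%N ->
  part n (block_fun m f) <= c ^+ 2 * part n f.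
Proof.
move=> [c0 mc] Sn; rewrite -(ler_pMn2r card_gt0) -mulrnAr.
rewrite /part -!(sum_mv _ Sn) mulr_sumr; apply: ler_sum => y _.
by under eq_bigr do rewrite block_fun_mv; exact: mc.
Qed.

Lemma block_fun_partW m x c n : mbound m c ->
  part n (block_fun m x) <= (c * hn x) ^+ 2.
Proof.
(* [Fn n] is a union of cosets of the finite summand only from [split_size S] on, so a smaller [n]
   is first enlarged. *)
move=> mc; apply: le_trans (part_le _ (leq_maxl n (split_size S))) _.
apply: le_trans (block_fun_part _ mc (leq_maxr _ _)) _.
by rewrite exprMn ler_wpM2l ?sqr_ge0// part_le_hn.
Qed.

Fact block_fun_l2 m x : block_fun m x \in @l2pred R.
Proof.
have [c mc] := mbound_ex m; apply/l2predP; exists (c * hn x).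
  by rewrite mulr_ge0 ?hn_ge0//; case: mc.
by move=> n; exact: block_fun_partW.
Qed.

Definition block_op m x : l2 := L2 (block_fun_l2 m x).

Lemma block_opE m x p : block_op m x p = \sum_t m (rho p) t * x (mv t p).
Proof. by []. Qed.

Lemma block_op_bound m x c : mbound m c -> hn (block_op m x) <= c * hn x.
Proof.
move=> mc; apply: hn_le; first by rewrite mulr_ge0 ?hn_ge0//; case: mc.
by move=> n; exact: block_fun_partW.
Qed.

Lemma block_op_comb m m' (a : C) x :
  block_op (fun s t => a * m s t + m' s t) x =
    a *: block_op m x + block_op m' x.
Proof.
apply: l2_ext => p; rewrite l2D l2Z !block_opE mulr_sumr -big_split/=.
by apply: eq_bigr => t _; rewrite mulrDl mulrA.
Qed.

Lemma block_op_mul m m' x : block_op (mmul m m') x = block_op m (block_op m' x).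
Proof.
apply: l2_ext => p; rewrite !block_opE.
under eq_bigr do rewrite mulr_suml.
rewrite exchange_big/=; apply: eq_bigr => s _.
rewrite block_fun_mv mulr_sumr; apply: eq_bigr => t _.
by rewrite mulrA.
Qed.

Lemma block_op_one x : block_op (@mone S) x = x.
Proof.
apply: l2_ext => p; rewrite block_opE (bigD1 (rho p))//= big1 => [|t tp].
  by rewrite /mone eqxx mul1r addr0 mv_rho.
by rewrite /mone eq_sym (negPf tp) mul0r.
Qed.

Lemma hdotE x y : hdot x y = l2dot x y. Proof. by []. Qed.

(** The partial sums of the two inner products agree from [split_size S] on: multiplied by [#|S|]
    they are sums over cosets, where the identity is that of finite matrices. *)
Lemma block_op_adj m x y : hdot (block_op m x) y = hdot x (block_op (madj m) y).
Proof.
rewrite !hdotE; apply: (clim_unique (l2dot_lim _ _)).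
suff H n : (split_size S <= n)%N ->
    \sum_(p <- Fn n) block_op m x p * Num.conj (y p) =
    \sum_(p <- Fn n) x p * Num.conj (block_op (madj m) y p).
  have [a b] := l2dot_lim x (block_op (madj m) y).
  split; [apply: cvg_trans a|apply: cvg_trans b]; apply: near_eq_cvg;
    by exists (split_size S) => // n /= Sn; rewrite H.
move=> Sn; have := card_gt0; set k := #|_| => k0.
suff : (\sum_(p <- Fn n) block_op m x p * Num.conj (y p)) *+ k =
    (\sum_(p <- Fn n) x p * Num.conj (block_op (madj m) y p)) *+ k.
  exact: (pmulrnI k0).
rewrite /k -!(sum_mv _ Sn); apply: eq_bigr => p _.
have E s : Num.conj (block_op (madj m) y (mv s p)) =
    \sum_t m t s * Num.conj (y (mv t p)).
  rewrite /= block_fun_mv rmorph_sum; apply: eq_bigr => t _.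
  by apply: complex_ext; rewrite /madj !CE; ring.
under eq_bigr do rewrite /= block_fun_mv mulr_suml.
under [RHS]eq_bigr do rewrite E mulr_sumr.
rewrite exchange_big/=; apply: eq_bigr => t _; apply: eq_bigr => s _.
by rewrite [RHS]mulrCA mulrA.
Qed.

End Gm.

Section Hdot.
Context {R : realType}.
Local Notation C := R[i].
Local Notation l2 := (l2 R).
Implicit Types (x y z : l2) (c : C).

Lemma hdotDr x y z : hdot x (y + z) = hdot x y + hdot x z.
Proof. by rewrite (hdotC (y + z) x) (hdotC y x) (hdotC z x) hdotDl rmorphD. Qed.

Lemma hdotZr c x y : hdot x (c *: y) = Num.conj c * hdot x y.
Proof. by rewrite (hdotC (c *: y) x) (hdotC y x) hdotZl rmorphM. Qed.

Lemma hdotNr x y : hdot x (- y) = - hdot x y.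
Proof. by rewrite -scaleN1r hdotZr rmorphN1 mulN1r. Qed.

Lemma hdotBr x y z : hdot x (y - z) = hdot x y - hdot x z.
Proof. by rewrite hdotDr hdotNr. Qed.

Lemma hdotNl x y : hdot (- x) y = - hdot x y.
Proof. by rewrite -scaleN1r hdotZl mulN1r. Qed.

Lemma hdot_hn2 x : hdot x x = (hn2 x)%:C.
Proof. by rewrite hdotxx l2normE -rmorphXn hn_sqr. Qed.

Lemma hdot_inj x y : (forall z, hdot z x = hdot z y) -> x = y.
Proof.
move=> xy; apply/eqP; rewrite -subr_eq0; apply/eqP/hn_eq0.
have : hdot (x - y) (x - y) = 0 by rewrite hdotBr xy subrr.
by rewrite hdot_hn2 => /complexI h; rewrite /hn h sqrtr0.
Qed.

Lemma hn2B x y c :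
  hn2 (x - c *: y) = hn2 x + nsq c * hn2 y - 2 * Re (Num.conj c * hdot x y).
Proof.
have : hdot (x - c *: y) (x - c *: y) = (hn2 x)%:C + (nsq c * hn2 y)%:C
    - (Num.conj c * hdot x y + Num.conj (Num.conj c * hdot x y)).
  rewrite hdotBr !hdotDl !hdotNl hdotZr !hdotZl hdotZr !hdot_hn2.
  rewrite (hdotC x y).
  by apply: complex_ext; rewrite !CE /nsq; ring.
rewrite hdot_hn2 => /(congr1 (@Re R)); rewrite !CE => ->; ring.
Qed.

Lemma cauchy_schwarz x y : nsq (hdot x y) <= hn2 x * hn2 y.
Proof.
have [y0|y0] := eqVneq (hn2 y) 0.
  have -> : y = 0 by apply: hn_eq0; rewrite /hn y0 sqrtr0.
  rewrite -[X in hdot x X](subrr 0) hdotBr subrr nsq0.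
  by rewrite mulr_ge0 ?hn2_ge0.
have yp : 0 < hn2 y by rewrite lt_neqAle eq_sym y0 hn2_ge0.
have := hn2_ge0 (x - ((hn2 y)^-1)%:C * hdot x y *: y).
rewrite hn2B -(pmulr_rge0 _ yp) => h; rewrite -subr_ge0; apply: le_trans h _.
rewrite le_eqVlt; apply/orP; left; apply/eqP; move: (hdot x y) => z.
by rewrite nsqM nsqC !CE /nsq; field.
Qed.

Lemma cauchy_schwarz_hn x y : Num.sqrt (nsq (hdot x y)) <= hn x * hn y.
Proof.
rewrite -(ler_pXn2r (_ : 0 < 2)%N) ?nnegrE ?sqrtr_ge0 ?mulr_ge0 ?hn_ge0//.
by rewrite sqr_sqrtr ?nsq_ge0// exprMn !hn_sqr cauchy_schwarz.
Qed.

End Hdot.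

Lemma sumFn_seq (V : nmodType) (h : G -> V) (r : seq G) n : uniq r ->
  (forall p, p \notin r -> h p = 0) -> {subset r <= Fn n} ->
  \sum_(p <- Fn n) h p = \sum_(p <- r) h p.
Proof.
move=> ur h0 rn; rewrite (bigID (mem r))/= [X in _ + X]big1 ?addr0//.
rewrite -big_filter; apply: perm_big; apply: uniq_perm => // [|p].
  by rewrite filter_uniq ?Fn_uniq.
by rewrite mem_filter; case: (boolP (p \in r)) => //= /rn.
Qed.

Definition seq_size (r : seq G) : nat := \max_(p <- r) size (p : {poly 'F_2}).

Lemma seq_size_sub r n : (seq_size r <= n)%N -> {subset r <= Fn n}.
Proof.
move=> rn p pr; rewrite mem_Fn; apply: leq_trans rn.
by rewrite /seq_size (big_rem p)//= leq_maxl.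
Qed.

Section Fs.
Context {R : realType}.
Local Notation C := R[i].
Local Notation l2 := (l2 R).
Implicit Types (x y z : l2) (c : G -> C).

Definition fin_fun (r : seq G) c : G -> C :=
  fun p => if p \in r then c p else 0.

Lemma part_fin_fun r c n : uniq r -> (seq_size r <= n)%N ->
  part n (fin_fun r c) = \sum_(p <- r) nsq (c p).
Proof.
move=> ur rn; rewrite /part (sumFn_seq ur _ (seq_size_sub rn)).
  by apply: eq_big_seq => p pr; rewrite /fin_fun pr.
by move=> p /negPf pr; rewrite /fin_fun pr nsq0.
Qed.

Lemma part_fin_fun_le r c n : uniq r ->
  part n (fin_fun r c) <= \sum_(p <- r) nsq (c p).
Proof.
move=> ur; apply: le_trans (part_le _ (leq_maxl n (seq_size r))) _.
by rewrite part_fin_fun// leq_maxr.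
Qed.

Fact fin_fun_l2 r c : fin_fun r c \in @l2pred R.
Proof.
have -> : fin_fun r c = fin_fun (undup r) c.
  by apply/funext => p; rewrite /fin_fun mem_undup.
apply/asboolP; exists (\sum_(p <- undup r) nsq (c p)) => n.
exact: part_fin_fun_le (undup_uniq r).
Qed.

Definition fin_vec r c : l2 := L2 (fin_fun_l2 r c).

Lemma fin_vecE r c p : fin_vec r c p = if p \in r then c p else 0.
Proof. by []. Qed.

Lemma hn2_fin_vec r c : uniq r -> hn2 (fin_vec r c) = \sum_(p <- r) nsq (c p).
Proof.
move=> ur; apply: (cvg_unique _ (part_cvg (fin_vec r c))) => //.
by apply: cvg_near_cst; exists (seq_size r) => // n /=; exact: part_fin_fun.
Qed.

Lemma hdot_fin_vec x r c : uniq r ->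
  hdot x (fin_vec r c) = \sum_(p <- r) x p * Num.conj (c p).
Proof.
move=> ur; rewrite hdotE; apply: clim_unique (l2dot_lim _ _) _.
apply: (@clim_eventually _ _ _ (seq_size r)) => n rn.
rewrite (sumFn_seq ur _ (seq_size_sub rn)).
  by apply: eq_big_seq => p pr; rewrite fin_vecE pr.
by move=> p /negPf pr; rewrite fin_vecE pr rmorph0 mulr0.
Qed.

Lemma hn2_trunc x n : hn2 (x - fin_vec (Fn n) x) = hn2 x - part n x.
Proof.
have : forall p, (x - fin_vec (Fn n) x) p = if p \in Fn n then 0 else x p.
  by move=> p; rewrite l2B fin_vecE; case: ifP; rewrite ?subrr ?subr0.
move: (x - _) => w wE; apply: (cvg_unique _ (part_cvg w)) => //.
apply: cvg_trans (cvgB (part_cvg x) (cvg_cst (part n x))).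
apply: near_eq_cvg; exists n => // m /= nm.
have e : part m x = part n x + \sum_(p <- Fn m | p \notin Fn n) nsq (x p).
  by rewrite /part (bigID (mem (Fn n)))/= sumFn_sub.
have -> : part m w = \sum_(p <- Fn m | p \notin Fn n) nsq (x p).
  rewrite /part (bigID (mem (Fn n)))/= big1 ?add0r => [|p pn].
    by apply: eq_bigr => p /negPf pn; rewrite wE pn.
  by rewrite wE pn nsq0.
change (part m x - part n x = \sum_(p <- Fn m | p \notin Fn n) nsq (x p)).
by rewrite e addrC addKr.
Qed.

End Fs.

(** * Refining splittings; directedness *)

HB.instance Definition _ (U V : finZmodType) := GRing.Zmodule.on (U * V)%type.

(** This says that [v] lies in the finite summand; dually, [factors S chi] says that [chi] depends
    only on the component in that summand. *)
Definition fixes (S : splitting) (v : G) : Prop := iota (rho v : S) = v.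
Definition factors (S : splitting) (chi : G -> 'F_2) : Prop :=
  forall y, chi (iota (rho y : S)) = chi y.
(** The finite summand grows and the complement shrinks. These are the two conditions that put the
    matrix algebra of [S1] inside that of [S]. *)
Definition splitting_le (S1 S : splitting) : Prop :=
  (forall u : S1, fixes S (iota u)) /\
  (forall y, rho (iota (rho y : S)) = rho y :> S1).

Lemma splitting_le_refl S : splitting_le S S.
Proof. by split=> u; rewrite /fixes rhoK. Qed.

Lemma splitting_le_fixes S1 S v : splitting_le S1 S -> fixes S1 v -> fixes S v.
Proof. by move=> [h _] <-; exact: h. Qed.

Lemma splitting_le_factors S1 S chi : splitting_le S1 S -> factors S1 chi ->
  factors S chi.
Proof. by move=> [_ h] c y; rewrite -c h c. Qed.

Lemma splitting_le_trans S1 S2 S3 : splitting_le S1 S2 -> splitting_le S2 S3 ->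
  splitting_le S1 S3.
Proof.
move=> h12 h23; split=> [u|y]; first by apply: splitting_le_fixes h23 _;
  apply: h12.1.
by rewrite -h12.2 h23.2 h12.2.
Qed.

Lemma F2_case (c : 'F_2) : c = 0 \/ c = 1.
Proof.
by case: c => [[|[|//]] i]; [left|right]; exact: val_inj.
Qed.

(* One step of Gaussian elimination: [p] joins the finite summand and [chi] the
   coordinates on it. *)
Section Extend.
Variables (S : splitting) (chi : G -> 'F_2) (p : G).
Hypothesis chiD : {morph chi : x y / x + y}.
Hypothesis chip : chi p = 1.
Hypothesis chi_iota : forall u : S, chi (iota u) = 0.
Hypothesis rhop : rho p = 0 :> S.

Let cp (c : 'F_2) : G := (c *: (p : {poly 'F_2}))%R.

Let cpD c d : cp (c + d) = cp c + cp d. Proof. exact: scalerDl. Qed.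

Let chi_cp c : chi (cp c) = c.
Proof.
by case: (F2_case c) => ->; rewrite /cp ?scale0r ?scale1r ?chip ?(addf0 chiD).
Qed.

Let rho_cp c : rho (cp c) = 0 :> S.
Proof.
by case: (F2_case c) => ->;
  rewrite /cp ?scale0r ?scale1r ?rhop ?(addf0 (@rhoD S)).
Qed.

Let er (y : G) : S * 'F_2 := (rho y, chi y).
Let ei (v : S * 'F_2) : G := iota v.1 + cp v.2.

Let erD : {morph er : x y / x + y}.
Proof. by move=> x y; rewrite /er rhoD chiD. Qed.
Let eiD : {morph ei : x y / x + y}.
Proof. by move=> x y; rewrite /ei iotaD cpD addrACA. Qed.
Let erK : cancel ei er.
Proof.
by move=> [u c];
  rewrite /er /ei rhoD rhoK rho_cp chiD chi_iota chi_cp addr0 add0r.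
Qed.

Definition splitting_ext : splitting :=
  @Splitting (S * 'F_2)%type er ei erD eiD erK.

Lemma splitting_le_ext : splitting_le S splitting_ext.
Proof.
split=> [u|y]; rewrite /fixes /= /ei /=.
  by rewrite rhoK chi_iota /cp scale0r addr0.
by rewrite rhoD rhoK rho_cp addr0.
Qed.

Lemma splitting_ext_proj y :
  iota (rho y : splitting_ext) = iota (rho y : S) + cp (chi y).
Proof. by []. Qed.

End Extend.

(** Projecting onto the complement produces the data of [splitting_ext]: the component [p] of [y0]
    is killed by [rho], and [chi1] after the projection kills the finite summand. *)
Lemma extend_proj (S : splitting) (chi1 : G -> 'F_2) (y0 : G) :
  {morph chi1 : x y / x + y} -> chi1 (y0 - iota (rho y0 : S)) != 0 ->
  exists2 S', splitting_le S S' & forall y, iota (rho y : S') =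
    iota (rho y : S) +
    chi1 (y - iota (rho y : S)) *: ((y0 - iota (rho y0 : S)) : {poly 'F_2}).
Proof.
move=> chiD; set p := y0 - _ => chip.
have {}chip : chi1 p = 1 by case: (F2_case (chi1 p)) chip => ->.
have rhop : rho p = 0 :> S by rewrite /p (addfB (@rhoD S)) rhoK subrr.
pose chi y := chi1 (y - iota (rho y : S)).
have chi'D : {morph chi : x y / x + y}.
  by move=> x y; rewrite /chi -chiD rhoD iotaD opprD addrACA.
have chi'i (u : S) : chi (iota u) = 0 by rewrite /chi rhoK subrr (addf0 chiD).
have chi'p : chi p = 1.
  by rewrite /chi rhop (addf0 (@iotaD S)) subr0.
exists (splitting_ext chi'D chi'p chi'i rhop); first exact: splitting_le_ext.
by move=> y; exact: splitting_ext_proj.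
Qed.

Lemma extend_fixes (S : splitting) v :
  exists2 S', splitting_le S S' & fixes S' v.
Proof.
have [v0|v0] := eqVneq (v - iota (rho v : S)) 0.
  by exists S; [exact: splitting_le_refl|apply/esym/eqP; rewrite -subr_eq0 v0].
(* A nonzero component in the complement is detected by some coefficient, which becomes the new
   coordinate functional. *)
have [i vi] : exists i, (v - iota (rho v : S) : {poly 'F_2})`_i != 0.
  apply: contrapT => /forallNP h; move/eqP: v0; apply; apply/polyP => i.
  by rewrite coef0; apply/eqP/negPn/negP; exact: h.
have [||S' SS' h] := @extend_proj S (fun y => (y : {poly 'F_2})`_i) v.
- by move=> x y; exact: coefD.
- by [].
exists S' => //; rewrite /fixes h.
case: (F2_case (v - iota (rho v : S) : {poly 'F_2})`_i) vi => -> // _.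
by rewrite scale1r addrC subrK.
Qed.

(** Unless [chi] already vanishes on the complement, a vector of the complement on which it is 1 is
    moved to the finite summand. As [chi] is any additive map, every character of [G] ends up in a
    local matrix algebra. *)
Lemma extend_factors (S : splitting) (chi : G -> 'F_2) :
  {morph chi : x y / x + y} ->
  exists2 S', splitting_le S S' & factors S' chi.
Proof.
move=> chiD; have [h|] := pselect (forall y, chi (y - iota (rho y : S)) = 0).
  exists S; first exact: splitting_le_refl.
  by move=> y; apply/esym/eqP; rewrite -subr_eq0 -(addfB chiD) h.
move=> /existsNP[y0 /eqP y0P].
have [S' SS' h] := extend_proj chiD y0P.
exists S' => // y; rewrite h chiD addrC.
set z := y0 - _; have z1 : chi z = 1 by case: (F2_case (chi z)) y0P => ->.
set w := y - _.
have -> : chi (chi w *: (z : {poly 'F_2})) = chi w.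
  by case: (F2_case (chi w)) => ->; rewrite ?scale0r ?scale1r ?z1 ?(addf0 chiD).
by rewrite /w (addfB chiD) subrK.
Qed.

Lemma extend_fixes_seq (S : splitting) (r : seq G) :
  exists2 S', splitting_le S S' & forall v, v \in r -> fixes S' v.
Proof.
elim: r => [|v r [S1 SS1 h]]; first by exists S => //; exact: splitting_le_refl.
have [S2 S12 hv] := extend_fixes S1 v.
exists S2; first exact: splitting_le_trans S12.
by move=> w; rewrite inE => /orP[/eqP->//|/h]; exact: splitting_le_fixes.
Qed.

Lemma extend_factors_seq (S : splitting) (chi : nat -> G -> 'F_2) n :
  (forall i, {morph chi i : x y / x + y}) ->
  exists2 S', splitting_le S S' & forall i, (i < n)%N -> factors S' (chi i).
Proof.
move=> chiD; elim: n => [|n [S1 SS1 h]]; first by exists S => //;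
  exact: splitting_le_refl.
have [S2 S12 hv] := extend_factors S1 (chiD n).
exists S2; first exact: splitting_le_trans S12.
move=> i; rewrite ltnS leq_eqVlt => /orP[/eqP->//|/h];
  exact: splitting_le_factors.
Qed.

(** Only finitely many vectors and functionals of [S2] have to be absorbed: the points of its finite
    summand, and the coefficients of the projection onto it, which vanish from [split_size S2]
    on. *)
Lemma splitting_directed S1 S2 :
  exists2 S, splitting_le S1 S & splitting_le S2 S.
Proof.
have [S3 S13 h3] := extend_fixes_seq S1 (codom (@iota S2)).
pose chi i y := (iota (rho y : S2) : {poly 'F_2})`_i.
have chiD i : {morph chi i : x y / x + y}.
  by move=> x y; rewrite /chi rhoD iotaD; exact: coefD.
have [S S3S h] := extend_factors_seq S3 (split_size S2) chiD.
exists S; first exact: splitting_le_trans S3S.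
split=> [u|y].
  by apply: splitting_le_fixes S3S _; apply: h3; exact: codom_f.
rewrite -[LHS]rhoK -[RHS]rhoK; congr rho; apply/polyP => i.
have [iS|Si] := ltnP i (split_size S2); first exact: h.
by rewrite !nth_default// (leq_trans (size_iota _)).
Qed.

Definition splitting0 : splitting := @Splitting 'rV['F_2]_0 (fun=> 0) (fun=> 0)
  (fun _ _ => esym (addr0 0)) (fun _ _ => esym (addr0 0))
  (fun u => esym (thinmx0 u)).

Section Le.
Context {R : realType}.
Local Notation C := R[i].
Local Notation l2 := (l2 R).

(** The larger matrix is [m] tensored with an identity: [tau s t] is the point of [S] reached from
    [s] when its [S1]-coordinate is changed to [t]. *)
Lemma block_op_le (S1 S : splitting) (m : S1 -> S1 -> C) : splitting_le S1 S ->
  exists m' : S -> S -> C, forall x : l2, block_op m x = block_op m' x.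
Proof.
move=> [Si Sr]; pose tau (s : S) (t : S1) : S :=
  s + rho (iota (t - rho (iota s))).
exists (fun s u => \sum_(t | tau s t == u) m (rho (iota s)) t) => x.
apply: l2_ext => p; rewrite !block_opE.
under [RHS]eq_bigr do rewrite mulr_suml.
rewrite (partition_big (tau (rho p)) xpredT)//=; apply: eq_bigr => u _.
rewrite Sr; apply: eq_bigr => t /eqP <-; congr (_ * x _).
by rewrite /mv /tau Sr addrAC subrr add0r Si.
Qed.

(** Transfers [block_op_le] to adjoints without looking at the matrix found there: the operator
    determines its adjoint. *)
Lemma block_op_adj_eq (S1 S : splitting)
    (m : S1 -> S1 -> C) (m' : S -> S -> C) :
  (forall x : l2, block_op m x = block_op m' x) ->
  forall x : l2, block_op (madj m) x = block_op (madj m') x.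
Proof. by move=> mm' x; apply: hdot_inj => y; rewrite -!block_op_adj mm'. Qed.

End Le.

Section Alg.
Context (R : realType).
Local Notation C := R[i].
Local Notation l2 := (l2 R).
Implicit Types (x y z : l2) (a b : l2 -> l2).

Definition cn (c : C) : R := Num.sqrt (nsq c).
Lemma cn_ge0 c : 0 <= cn c. Proof. exact: sqrtr_ge0. Qed.

Lemma hnN x : hn (- x) = hn x.
Proof.
rewrite -scaleN1r hnZ.
have -> : nsq (-1 : C) = 1 by rewrite nsqN -[1]/(1%:C) nsqC expr1n.
by rewrite sqrtr1 mul1r.
Qed.

Lemma hnB x y : hn (x - y) = hn (y - x). Proof. by rewrite -hnN opprB. Qed.

Lemma hn_tri x y z : hn (x - z) <= hn (x - y) + hn (y - z).
Proof. by apply: le_trans (hnD _ _); rewrite addrA subrK. Qed.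

Lemma hn0 : hn (0 : l2) = 0.
Proof. by have /complexI := @normr0 _ l2. Qed.

Lemma madjK (U : finType) (m : U -> U -> C) : madj (madj m) = m.
Proof.
by apply/funext => s; apply/funext => t; apply: complex_ext;
  rewrite /madj !CE ?opprK.
Qed.

(** * The C*-algebra *)

(* Approximating [a] and its adjoint [b] at the same time makes the adjoint
   available without the Riesz representation theorem. *)
Definition approx a b :=
  forall e : R, 0 < e -> exists (S : splitting) (m : S -> S -> C),
  (forall x, hn (a x - block_op m x) <= e * hn x) /\
  (forall x, hn (b x - block_op (madj m) x) <= e * hn x).

Lemma approx_sym a b : approx a b -> approx b a.
Proof.
move=> ab e /ab[S [m [am bm]]]; exists S, (madj m); split => //.
by rewrite madjK.
Qed.

Lemma approx_block (S : splitting) (m : S -> S -> C) :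
  approx (block_op m) (block_op (madj m)).
Proof.
by move=> e e0; exists S, m; split=> x; rewrite subrr hn0 mulr_ge0 ?hn_ge0 ?ltW.
Qed.

Lemma approx_adj a b : approx a b -> forall x y, hdot (a x) y = hdot x (b y).
Proof.
move=> ab x y; apply/eqP; rewrite -subr_eq0 -normr_eq0 normE -/(cn _).
suff /eqP -> : cn (hdot (a x) y - hdot x (b y)) == 0 by [].
rewrite eq_le cn_ge0 andbT; apply/ler_addgt0Pr => e e0; rewrite add0r.
pose k := hn x * hn y; have k0 : 0 <= k by rewrite mulr_ge0 ?hn_ge0.
(* The two approximation errors add up to [d * (2 * k)]; the added 1 keeps the divisor positive when
   [x] or [y] is zero. *)
have kp : 0 < 2 * k + 1 by rewrite ltr_wpDl// mulr_ge0.
have d0 : 0 < e / (2 * k + 1) by rewrite divr_gt0.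
have [S [m [am bm]]] := ab _ d0; set d := e / _ in d0 am bm.
have -> : hdot (a x) y - hdot x (b y) =
    hdot (a x - block_op m x) y - hdot x (b y - block_op (madj m) y).
  by rewrite hdotBr hdotDl hdotNl block_op_adj opprB addrA subrK.
have tri (z w : C) : cn (z - w) <= cn z + cn w.
  rewrite -lecR rmorphD/= /cn -!normE -[in leRHS](normrN w); exact: ler_normD.
apply: le_trans (tri _ _) _.
have h1 := cauchy_schwarz_hn (a x - block_op m x) y.
have h2 := cauchy_schwarz_hn x (b y - block_op (madj m) y).
apply: le_trans (lerD h1 h2) _.
apply: (@le_trans _ _ (d * hn x * hn y + hn x * (d * hn y))).
  by apply: lerD; [rewrite ler_wpM2r ?hn_ge0|rewrite ler_wpM2l ?hn_ge0].
have -> : d * hn x * hn y + hn x * (d * hn y) = d * (2 * k) by rewrite /k; ring.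
rewrite /d mulrAC ler_pdivrMr//.
by rewrite ler_pM2l// lerDl.
Qed.

Lemma hdot_injl x y : (forall z, hdot x z = hdot y z) -> x = y.
Proof.
by move=> xy; apply: hdot_inj => z; rewrite (hdotC x z) (hdotC y z) xy.
Qed.

Lemma approx_uniq a b b' : approx a b -> approx a b' -> b = b'.
Proof.
move=> /approx_adj ab /approx_adj ab'; apply/funext => y.
by apply: hdot_inj => x; rewrite -ab ab'.
Qed.

(** A map with an adjoint is linear, so linearity does not have to be carried along in the
    definition of the algebra. *)
Lemma approx_linear a b : approx a b ->
  forall (c : C) x y, a (c *: x + y) = c *: a x + a y.
Proof.
move=> /approx_adj ab c x y; apply: hdot_injl => z.
by rewrite ab !hdotDl !hdotZl !ab.
Qed.

Definition bounded_by a (c : R) := 0 <= c /\ forall x, hn (a x) <= c * hn x.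

Lemma approx_bounded a b : approx a b -> exists c, bounded_by a c.
Proof.
move=> /(_ _ ltr01)[S [m [am _]]]; have [c cm] := mbound_ex m.
have c0 : 0 <= c by case: cm.
exists (1 + c); split; first by rewrite addr_ge0.
move=> x; rewrite -(subrK (block_op m x) (a x)) mulrDl.
by apply: le_trans (hnD _ _) _; apply: lerD (am x) (block_op_bound x cm).
Qed.

Lemma bounded_byW a c d : bounded_by a c -> c <= d -> bounded_by a d.
Proof.
move=> [c0 ac] cd; split=> [|x]; first exact: le_trans cd.
by apply: le_trans (ac x) _; rewrite ler_wpM2r ?hn_ge0.
Qed.

Lemma approx_comb (c : C) a b a' b' : approx a b -> approx a' b' ->
  approx (c *: a + a') (Num.conj c *: b + b').
Proof.
move=> ab ab' e e0; pose d := e / (cn c + 1).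
have k0 : 0 < cn c + 1 by rewrite ltr_wpDl ?cn_ge0.
have d0 : 0 < d by rewrite divr_gt0.
have [S1 [m1 [am bm]]] := ab _ d0; have [S2 [m2 [am' bm']]] := ab' _ d0.
have [S S1S S2S] := splitting_directed S1 S2.
have [n1 e1] := block_op_le m1 S1S; have [n2 e2] := block_op_le m2 S2S.
have e1' := block_op_adj_eq e1; have e2' := block_op_adj_eq e2.
have key (c' : C) u v u' v' x : cn c' = cn c -> hn (u - v) <= d * hn x ->
    hn (u' - v') <= d * hn x ->
    hn ((c' *: u + u') - (c' *: v + v')) <= e * hn x.
  move=> cpx h h'; rewrite opprD addrACA -scalerBr.
  apply: le_trans (hnD _ _) _; rewrite hnZ -/(cn c') cpx.
  have -> : e * hn x = cn c * (d * hn x) + d * hn x.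
    by rewrite /d; field; rewrite gt_eqF.
  by apply: lerD => //; rewrite ler_wpM2l ?cn_ge0.
exists S, (fun s t => c * n1 s t + n2 s t); split=> x.
  by rewrite block_op_comb -e1 -e2; exact: key.
have -> : madj (fun s t => c * n1 s t + n2 s t) =
    (fun s t => Num.conj c * madj n1 s t + madj n2 s t).
  by apply/funext => s; apply/funext => t; rewrite /madj rmorphD rmorphM.
rewrite block_op_comb -e1' -e2'; apply: key => //.
by rewrite /cn /nsq !CE sqrrN.
Qed.

Lemma approx_mul a b a' b' : approx a b -> approx a' b' ->
  approx (a \o a') (b' \o b).
Proof.
move=> ab ab' e e0.
have [k1 a1] := approx_bounded ab.
have [k2 a2] := approx_bounded (approx_sym ab).
have [k3 a3] := approx_bounded ab'.
have [k4 a4] := approx_bounded (approx_sym ab').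
pose k := k1 + k2 + k3 + k4.
have p1 : 0 <= k1 by case: a1. have p2 : 0 <= k2 by case: a2.
have p3 : 0 <= k3 by case: a3. have p4 : 0 <= k4 by case: a4.
have {}a1 : bounded_by a k by apply: bounded_byW a1 _; rewrite /k; lra.
have {}a2 : bounded_by b k by apply: bounded_byW a2 _; rewrite /k; lra.
have {}a3 : bounded_by a' k by apply: bounded_byW a3 _; rewrite /k; lra.
have {}a4 : bounded_by b' k by apply: bounded_byW a4 _; rewrite /k; lra.
have k0 : 0 <= k by case: a1.
have kp : 0 < 2 * k + 1 by rewrite ltr_wpDl// mulr_ge0.
(* The error of a product will be [d * (2 * k + d)]; capping [d] at 1 bounds it by
   [d * (2 * k + 1)], hence by [e]. *)
pose d := Num.min 1 (e / (2 * k + 1)).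
have d0 : 0 < d by rewrite /d lt_min ltr01 divr_gt0.
have d1 : d <= 1 by rewrite /d ge_min lexx.
have de : d * (2 * k + 1) <= e.
  by rewrite -ler_pdivlMr// /d ge_min lexx orbT.
have [S1 [m1 [am bm]]] := ab _ d0; have [S2 [m2 [am' bm']]] := ab' _ d0.
have [S S1S S2S] := splitting_directed S1 S2.
have [n1 e1] := block_op_le m1 S1S; have [n2 e2] := block_op_le m2 S2S.
have e1' := block_op_adj_eq e1; have e2' := block_op_adj_eq e2.
(* Splits the error as $f(f'-g') + (f-g)g'$, where [g'] is bounded by [k + d]. It is applied to the
   product and, in reverse order, to the adjoints. *)
have key (f g f' g' : l2 -> l2) : bounded_by f k -> bounded_by f' k ->
    (forall (c : C) x y, f (c *: x + y) = c *: f x + f y) ->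
    (forall x, hn (f x - g x) <= d * hn x) ->
    (forall x, hn (f' x - g' x) <= d * hn x) ->
    forall x, hn (f (f' x) - g (g' x)) <= e * hn x.
  move=> [_ bf] [_ bf'] flin fg fg' x.
  have g'x : hn (g' x) <= (k + d) * hn x.
    rewrite -(subrK (f' x) (g' x)) mulrDl addrC.
    by apply: le_trans (hnD _ _) _; rewrite lerD// hnB.
  apply: le_trans (hn_tri _ (f (g' x)) _) _.
  have -> : f (f' x) - f (g' x) = f (f' x - g' x).
    by rewrite -scaleN1r addrC -flin scaleN1r addrC.
  apply: le_trans (lerD (bf _) (fg _)) _.
  apply: (@le_trans _ _ (k * (d * hn x) + d * ((k + d) * hn x))).
    by apply: lerD; rewrite ler_wpM2l// ltW.
  apply: (@le_trans _ _ (d * (2 * k + 1) * hn x)); last first.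
    by rewrite ler_wpM2r ?hn_ge0.
  have -> : k * (d * hn x) + d * ((k + d) * hn x) =
    d * (2 * k + d) * hn x by ring.
  by rewrite ler_wpM2r ?hn_ge0// ler_wpM2l ?(ltW d0)// lerD2l.
exists S, (mmul n1 n2); split=> x /=.
  rewrite block_op_mul; apply: (key a (block_op n1) a' (block_op n2)) => //.
  - exact: approx_linear ab.
  - by move=> {}x; rewrite -e1.
  - by move=> {}x; rewrite -e2.
have -> : madj (mmul n1 n2) = mmul (madj n2) (madj n1).
  apply/funext => s; apply/funext => t; rewrite /madj /mmul rmorph_sum/=.
  by apply: eq_bigr => u _; apply: complex_ext; rewrite !CE; ring.
rewrite block_op_mul;
  apply: (key b' (block_op (madj n2)) b (block_op (madj n1))) => //.
- exact: approx_linear (approx_sym ab').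
- by move=> {}x; rewrite -e2'.
- by move=> {}x; rewrite -e1'.
Qed.

Lemma approx_closed a b : (forall e : R, 0 < e -> exists a' b',
    [/\ approx a' b', forall x, hn (a x - a' x) <= e * hn x
      & forall x, hn (b x - b' x) <= e * hn x]) -> approx a b.
Proof.
move=> h e e0; have e20 : 0 < e / 2 by rewrite divr_gt0.
have [a' [b' [ab' aa' bb']]] := h _ e20.
have [S [m [am bm]]] := ab' _ e20.
have key u v w x : hn (u - v) <= e / 2 * hn x -> hn (v - w) <= e / 2 * hn x ->
    hn (u - w) <= e * hn x.
  move=> uv vw; apply: le_trans (hn_tri u v w) _.
  by rewrite [e]splitr mulrDl lerD.
by exists S, m; split=> x;
  [exact: key (aa' x) (am x)|exact: key (bb' x) (bm x)].
Qed.

Definition ccr_pred : {pred l2 -> l2} := fun a => `[< exists b, approx a b >].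

Lemma ccr_predP a : reflect (exists b, approx a b) (a \in ccr_pred).
Proof. exact: asboolP. Qed.

Lemma ccr_pred_submod : submod_closed ccr_pred.
Proof.
split=> [|c a a' /ccr_predP[b ab] /ccr_predP[b' ab']].
  apply/ccr_predP; exists 0 => e e0; exists splitting0, (fun _ _ => 0);
    split=> x;
  rewrite (_ : block_op _ _ = 0) ?subrr ?hn0 ?mulr_ge0 ?hn_ge0 ?ltW//;
  by apply: l2_ext => p; rewrite block_opE big1// => t _;
    rewrite /madj ?rmorph0 mul0r.
by apply/ccr_predP; exists (Num.conj c *: b + b'); exact: approx_comb.
Qed.

HB.instance Definition _ := GRing.isSubmodClosed.Build C (l2 -> l2) ccr_pred
  ccr_pred_submod.

Record ccr := Ccr { opf :> l2 -> l2; opfP : opf \in ccr_pred }.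
HB.instance Definition _ := [isSub of ccr for opf].
HB.instance Definition _ := [Choice of ccr by <:].
HB.instance Definition _ := [SubChoice_isSubLmodule of ccr by <:].

End Alg.

Section AlgStar.
Context (R : realType).
Local Notation C := R[i].
Local Notation l2 := (l2 R).
Local Notation A := (ccr R).
Implicit Types (x y z : l2) (a b : A).

Lemma A_ext a b : (forall x, a x = b x) -> a = b.
Proof. by move=> ab; apply: val_inj; apply/funext => x; exact: ab. Qed.

Lemma AD a b x : (a + b) x = a x + b x. Proof. by []. Qed.
Lemma AB a b x : (a - b) x = a x - b x. Proof. by []. Qed.
Lemma AZ c a x : (c *: a) x = c *: a x. Proof. by []. Qed.

Definition adjf a : l2 -> l2 := projT1 (cid (elimT (ccr_predP _) (opfP a))).

Lemma adjfP a : approx a (adjf a).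
Proof. by rewrite /adjf; case: cid. Qed.

Lemma A_of_approx (f g : l2 -> l2) : approx f g -> f \in @ccr_pred R.
Proof. by move=> fg; apply/ccr_predP; exists g. Qed.

Definition mk_ccr (f g : l2 -> l2) (fg : approx f g) : A :=
  Ccr (A_of_approx fg).

Lemma mk_ccrE f g (fg : approx f g) x : mk_ccr fg x = f x. Proof. by []. Qed.

Definition Astar a : A := mk_ccr (approx_sym (adjfP a)).
Definition Amul a b : A := mk_ccr (approx_mul (adjfP a) (adjfP b)).

Lemma AstarP a : approx a (Astar a). Proof. exact: adjfP. Qed.

Lemma Astar_eq a b : approx a b -> Astar a = b.
Proof.
by move=> ab; apply: val_inj; exact: approx_uniq (AstarP a) ab.
Qed.

Lemma A_adj a x y : hdot (a x) y = hdot x (Astar a y).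
Proof. exact: approx_adj (AstarP a) x y. Qed.

Lemma A_linear a (c : C) x y : a (c *: x + y) = c *: a x + a y.
Proof. exact: approx_linear (AstarP a) c x y. Qed.

Lemma AmulE a b x : Amul a b x = a (b x). Proof. by []. Qed.

Fact AmulA : associative Amul. Proof. by move=> a b c; apply: A_ext. Qed.

Lemma A_D a x y : a (x + y) = a x + a y.
Proof. by rewrite -[x in LHS]scale1r A_linear scale1r. Qed.
Lemma A_0 a : a 0 = 0.
Proof. by apply: (addrI (a 0)); rewrite -A_D !addr0. Qed.
Lemma A_Z a (c : C) x : a (c *: x) = c *: a x.
Proof. by rewrite -[c *: x]addr0 A_linear A_0 addr0. Qed.
Lemma A_B a x y : a (x - y) = a x - a y.
Proof. by rewrite -scaleN1r A_D A_Z scaleN1r. Qed.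

Fact AmulDl : left_distributive Amul +%R.
Proof. by move=> a b c; apply: A_ext. Qed.
Fact AmulDr : right_distributive Amul +%R.
Proof. by move=> a b c; apply: A_ext => x; rewrite AD !AmulE AD A_D. Qed.
Fact AmulZl (c : C) a b : Amul (c *: a) b = c *: Amul a b.
Proof. by apply: A_ext. Qed.
Fact AmulZr (c : C) a b : Amul a (c *: b) = c *: Amul a b.
Proof. by apply: A_ext => x; rewrite AZ !AmulE AZ A_Z. Qed.
Fact AstarK : involutive Astar.
Proof. by move=> a; apply: Astar_eq; apply: approx_sym; exact: AstarP. Qed.
Fact AstarZD (c : C) a b : Astar (c *: a + b) = Num.conj c *: Astar a + Astar b.
Proof. by apply: Astar_eq; apply: approx_comb; exact: AstarP. Qed.
Fact Astar0 : Astar 0 = 0.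
Proof.
have := AstarZD (-1) 0 0; rewrite scaler0 addr0 rmorphN1 scaleN1r addNr.
exact.
Qed.
Fact AstarD : {morph Astar : a b / a + b}.
Proof.
by move=> a b; rewrite -[a in LHS]scale1r AstarZD rmorph1 scale1r.
Qed.
Fact AstarZ (c : C) a : Astar (c *: a) = Num.conj c *: Astar a.
Proof. by rewrite -[c *: a]addr0 AstarZD Astar0 addr0. Qed.
Fact AstarB a b : Astar (a - b) = Astar a - Astar b.
Proof. by rewrite AstarD -scaleN1r AstarZ rmorphN1 scaleN1r. Qed.
Fact AstarM a b : Astar (Amul a b) = Amul (Astar b) (Astar a).
Proof. by apply: Astar_eq; apply: approx_mul; exact: AstarP. Qed.

HB.instance Definition _ := Lmodule_isStarAlgebra.Build R A
  AmulA AmulDl AmulDr AmulZl AmulZr AstarK AstarD AstarZ AstarM.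

Definition opn a : R := inf [set c | bounded_by a c].

Lemma opn_hasinf a : has_inf [set c | bounded_by a c].
Proof.
split; last by exists 0 => c [].
by have [c ac] := approx_bounded (AstarP a); exists c.
Qed.

Lemma opn_min a c : bounded_by a c -> opn a <= c.
Proof. by move=> ac; apply: ge_inf => //; case: (opn_hasinf a). Qed.

Lemma opn_ge0 a : 0 <= opn a.
Proof. by apply: lb_le_inf; [case: (opn_hasinf a)|move=> c []]. Qed.

Lemma opnP a x : hn (a x) <= opn a * hn x.
Proof.
have [x0|x0] := eqVneq (hn x) 0.
  by rewrite (hn_eq0 x0) A_0 hn0 mulr0.
have xp : 0 < hn x by rewrite lt_neqAle eq_sym x0 hn_ge0.
rewrite -ler_pdivrMr//; apply: lb_le_inf; first by case: (opn_hasinf a).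
by move=> c [_ ac]; rewrite ler_pdivrMr.
Qed.

Lemma opnD a b : opn (a + b) <= opn a + opn b.
Proof.
apply: opn_min; split; first by rewrite addr_ge0 ?opn_ge0.
by move=> x; apply: le_trans (hnD _ _) _; rewrite mulrDl lerD ?opnP.
Qed.

Lemma opnZ_le (c : C) a : opn (c *: a) <= cn c * opn a.
Proof.
apply: opn_min; split; first by rewrite mulr_ge0 ?opn_ge0 ?cn_ge0.
by move=> x; rewrite AZ hnZ -/(cn c) -mulrA ler_wpM2l ?cn_ge0 ?opnP.
Qed.

Lemma cnE (c : C) : `|c| = (cn c)%:C. Proof. by rewrite normE. Qed.

Lemma opnZ (c : C) a : opn (c *: a) = cn c * opn a.
Proof.
apply/eqP; rewrite eq_le opnZ_le/=.
have [->|c0] := eqVneq c 0.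
  by rewrite /cn nsq0 sqrtr0 mul0r opn_ge0.
have := opnZ_le c^-1 (c *: a); rewrite scalerA mulVf// scale1r => h.
have cp : 0 < cn c by rewrite -ltcR -cnE normr_gt0.
rewrite -ler_pdivlMl//; apply: le_trans h _.
suff -> : cn c^-1 = (cn c)^-1 by [].
by apply: complexI; rewrite -cnE normfV cnE fmorphV.
Qed.

Lemma opn_eq0 a : opn a = 0 -> a = 0.
Proof.
move=> a0; apply: A_ext => x; apply: hn_eq0; apply/eqP.
by rewrite eq_le hn_ge0 andbT (le_trans (opnP a x))// a0 mul0r.
Qed.

Fact A_normD a b : (opn (a + b))%:C <= (opn a)%:C + (opn b)%:C :> C.
Proof. by rewrite -rmorphD lecR opnD. Qed.
Fact A_normZ c a : (opn (c *: a))%:C = `|c| * (opn a)%:C.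
Proof. by rewrite opnZ rmorphM cnE. Qed.
Fact A_norm0 a : (opn a)%:C = 0 :> C -> a = 0.
Proof. by move=> /complexI; exact: opn_eq0. Qed.

HB.instance Definition _ := Lmodule_isNormed.Build C A
  A_normD A_normZ A_norm0.

Lemma AnormE a : `|a| = (opn a)%:C. Proof. by []. Qed.

Lemma opnM a b : opn (Amul a b) <= opn a * opn b.
Proof.
apply: opn_min; split; first by rewrite mulr_ge0 ?opn_ge0.
move=> x; rewrite AmulE; apply: le_trans (opnP _ _) _.
by rewrite -mulrA ler_wpM2l ?opn_ge0 ?opnP.
Qed.

(** Cauchy-Schwarz for $\|ax\|^2 = \langle x, a^*ax\rangle$. With submultiplicativity this makes
    [Astar] isometric, and then the C*-identity follows. *)
Lemma opn_sqr_le a : opn a ^+ 2 <= opn (Amul (Astar a) a).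
Proof.
set k := opn (Amul _ _); have k0 : 0 <= k by exact: opn_ge0.
rewrite -(sqr_sqrtr k0) ler_pXn2r ?nnegrE ?opn_ge0 ?sqrtr_ge0//.
apply: opn_min; split; first exact: sqrtr_ge0.
move=> x; rewrite -(ler_pXn2r (_ : 0 < 2)%N) ?nnegrE ?mulr_ge0 ?sqrtr_ge0
  ?hn_ge0//.
rewrite exprMn (sqr_sqrtr k0).
have h := cauchy_schwarz_hn x (Astar a (a x)).
have : (hn (a x) ^+ 2) <= hn x * hn (Astar a (a x)).
  apply: le_trans h; rewrite -A_adj hdot_hn2 -hn_sqr nsqC sqrtr_sqr.
  exact: ler_norm.
move=> /le_trans; apply; rewrite mulrC expr2 mulrA ler_wpM2r ?hn_ge0//.
by rewrite -AmulE opnP.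
Qed.

Lemma opn_star_le a : opn a <= opn (Astar a).
Proof.
have [a0|a0] := eqVneq (opn a) 0; first by rewrite a0 opn_ge0.
have ap : 0 < opn a by rewrite lt_neqAle eq_sym a0 opn_ge0.
by rewrite -(ler_pM2r ap) -expr2 (le_trans (opn_sqr_le a))// opnM.
Qed.

Lemma opn_star a : opn (Astar a) = opn a.
Proof.
by apply/eqP; rewrite eq_le opn_star_le -{2}(AstarK a) opn_star_le.
Qed.

Lemma opn_star_mul a : opn (Amul (Astar a) a) = opn a ^+ 2.
Proof.
apply/eqP; rewrite eq_le opn_sqr_le andbT.
by apply: le_trans (opnM _ _) _; rewrite opn_star expr2.
Qed.

Lemma near_bound (T : Type) (F : set_system T) (FF : ProperFilter F)
    (f : T -> l2) (l z : l2) (c : R) :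
  f @ F --> l -> (\forall t \near F, hn (z - f t) <= c) -> hn (z - l) <= c.
Proof.
move=> fl Fc; apply/ler_addgt0Pr => e e0.
have e0' : 0 < e%:C by rewrite ltcR.
have Fe : \forall t \near F, `|l - f t| < e%:C by move/cvgrPdist_lt: fl; apply.
have [t [zt tl]] := filter_ex (filterI Fc Fe).
apply: le_trans (hn_tri _ (f t) _) _; apply: lerD => //.
by rewrite hnB -lecR -l2normE ltW.
Qed.

(** The operators and their adjoints both converge pointwise, since [Astar] is isometric. The pair
    of limits is within any [e] of a pair [a], [Astar a], so [approx_closed] keeps it in the
    algebra. *)
Lemma A_complete (F : set_system A) : ProperFilter F -> cauchy F -> cvg F.
Proof.
move=> FF Fc.
have Fex : forall e : R, 0 < e -> exists a, F [set b | opn (a - b) < e].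
  move=> e e0; have /cauchyP/(_ e%:C)[|a Fa] := Fc; first by rewrite ltcR.
  by exists a; apply: filterS Fa => y; rewrite -ball_normE/= AnormE ltcR.
have limex (h : A -> A) x : (forall a b, opn (h a - h b) = opn (a - b)) ->
    exists l : l2, h b x @[b --> F] --> l.
  move=> hB; suff : cvg (h b x @[b --> F]) by move=> /cvg_ex.
  apply: l2_complete; apply/cauchyP => _ /gt0_complexE[e e0 ->].
  have k0 : 0 < hn x + 1 by rewrite ltr_wpDl ?hn_ge0.
  have d0 : 0 < e / (hn x + 1) by rewrite divr_gt0.
  have [a Fa] := Fex _ d0; exists (h a x).
  change (F [set b : A | ball (h a x) e%:C (h b x)]).
  apply: filterS Fa => b /= ab; rewrite -ball_normE/= -AB l2normE ltcR.
  apply: le_lt_trans (opnP _ _) _; rewrite hB.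
  apply: (@le_lt_trans _ _ (e / (hn x + 1) * hn x)).
    by rewrite ler_wpM2r ?hn_ge0// ltW.
  by rewrite mulrAC ltr_pdivrMr// ltr_pM2l// ltrDl.
have /choice[L LP] : forall x, exists l : l2, (b : A) x @[b --> F] --> l.
  by move=> x; exact: (limex id).
have /choice[L' LP'] : forall x, exists l : l2, (Astar b) x @[b --> F] --> l.
  move=> x; apply: (limex Astar) => a b; by rewrite -AstarB opn_star.
have bnd a (e : R) : F [set b | opn (a - b) < e] ->
    (forall x, hn (a x - L x) <= e * hn x) /\
      (forall x, hn (Astar a x - L' x) <= e * hn x).
  move=> Fa; split=> x.
    apply: near_bound (LP x) _; apply: filterS Fa => b /= ab.
    by rewrite -AB (le_trans (opnP _ _))// ler_wpM2r ?hn_ge0// ltW.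
  apply: near_bound (LP' x) _; apply: filterS Fa => b ab.
  rewrite -AB (le_trans (opnP _ _))// ler_wpM2r ?hn_ge0// ltW//.
  by rewrite -AstarB opn_star.
have LL' : approx L L'.
  apply: approx_closed => e e0; have [a /bnd[aL aL']] := Fex e e0.
  by exists a, (Astar a); split=> [|x|x]; rewrite 1?hnB //; exact: AstarP.
apply/cvg_ex; exists (mk_ccr LL'); apply: cauchy_limit => // a e e0 Fa.
rewrite AnormE lecR; apply: opn_min; split; first exact: ltW.
move=> x; rewrite AB mk_ccrE; apply: (proj1 (bnd a e _)).
by apply: filterS Fa => b; rewrite -ball_normE/= AnormE ltcR.
Qed.

HB.instance Definition _ := Uniform_isComplete.Build A A_complete.

Fact A_normM a b : `|smul a b| <= `|a| * `|b|.
Proof. by rewrite !AnormE -rmorphM lecR; exact: opnM. Qed.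
Fact A_norm_star a : `|smul (star a) a| = `|a| ^+ 2.
Proof. by rewrite !AnormE -rmorphXn; congr (_%:C); exact: opn_star_mul. Qed.

HB.instance Definition _ := StarAlgebra_isCstar.Build R A A_normM A_norm_star.

End AlgStar.

Lemma sum_only (V : nmodType) (I : finType) (i : I) (f : I -> V) :
  (forall j, j != i -> f j = 0) -> \sum_j f j = f i.
Proof.
by move=> f0; rewrite (bigD1 i)//= big1 ?addr0// => j /f0.
Qed.

(** * Dense local matrices and simplicity *)

Section Local.
Context {R : realType}.
Local Notation C := R[i].
Local Notation l2 := (l2 R).
Local Notation A := (ccr R).
Implicit Types (x y z : l2) (a b : A).

Definition blockA (S : splitting) (m : S -> S -> C) : A :=
  mk_ccr (approx_block m).

Lemma blockAE (S : splitting) (m : S -> S -> C) x :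
  blockA m x = block_op m x. Proof. by []. Qed.

Lemma smulE a b x : smul a b x = a (b x). Proof. by []. Qed.

Lemma blockA_star (S : splitting) (m : S -> S -> C) :
  star (blockA m) = blockA (madj m).
Proof. by apply: Astar_eq; exact: approx_block. Qed.

Lemma blockA_mul (S : splitting) (m n : S -> S -> C) :
  smul (blockA m) (blockA n) = blockA (mmul m n).
Proof. by apply: A_ext => x; rewrite smulE !blockAE block_op_mul. Qed.

Lemma blockA_comb (S : splitting) (c : C) (m n : S -> S -> C) :
  blockA (fun s t => c * m s t + n s t) = c *: blockA m + blockA n.
Proof. by apply: A_ext => x; rewrite blockAE block_op_comb. Qed.

Lemma opnN a : opn (- a) = opn a.
Proof. by have /complexI := normrN (a : A). Qed.

Lemma opnB a b : opn (a - b) <= opn a + opn b.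
Proof. by rewrite -(opnN b) opnD. Qed.

Definition A1 : A := blockA (@mone R splitting0).

Lemma A1E x : A1 x = x. Proof. by rewrite blockAE block_op_one. Qed.

Lemma smul1a a : smul A1 a = a.
Proof. by apply: A_ext => x; rewrite smulE A1E. Qed.
Lemma smula1 a : smul a A1 = a.
Proof. by apply: A_ext => x; rewrite smulE A1E. Qed.

Lemma blockA_le (S1 S : splitting) (m : S1 -> S1 -> C) : splitting_le S1 S ->
  exists m' : S -> S -> C, blockA m = blockA m'.
Proof.
by move=> /(block_op_le m)[m' mm']; exists m'; apply: A_ext => x; exact: mm'.
Qed.

Lemma blockA_dense a (e : R) : 0 < e ->
  exists (S : splitting) (m : S -> S -> C),
  opn (a - blockA m) <= e.
Proof.
move=> e0; have [S [m [am _]]] := AstarP a e0.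
exists S, m; apply: opn_min; split; first exact: ltW.
by move=> x; rewrite AB blockAE.
Qed.

Lemma blockA_dense_seq (F : seq A) (e : R) : 0 < e -> exists S : splitting,
  forall a, a \in F -> exists m : S -> S -> C, opn (a - blockA m) <= e.
Proof.
move=> e0; elim: F => [|a F [S1 h]]; first by exists splitting0.
have [S2 [m2 am]] := blockA_dense a e0.
have [S S1S S2S] := splitting_directed S1 S2; exists S => b.
rewrite inE => /orP[/eqP ->|/h[m bm]].
  by have [m' mm'] := blockA_le m2 S2S; exists m'; rewrite -mm'.
by have [m' mm'] := blockA_le m S1S; exists m'; rewrite -mm'.
Qed.

Definition delta (p : G) : l2 := fin_vec [:: p] (fun=> 1).

Lemma deltaE p q : delta p q = (q == p)%:R.
Proof. by rewrite fin_vecE inE; case: eqP. Qed.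

Lemma hdot_delta x p : hdot x (delta p) = x p.
Proof. by rewrite hdot_fin_vec// big_seq1 conjC1 mulr1. Qed.

Lemma nsq1 : nsq (1 : C) = 1.
Proof. by rewrite -[1]/(1%:C) nsqC expr1n. Qed.

Lemma hn_delta p : hn (delta p) = 1.
Proof. by rewrite /hn hn2_fin_vec// big_seq1 nsq1 sqrtr1. Qed.

Lemma A_coord a p q : a (delta q) p = Num.conj (Astar a (delta p) q).
Proof. by rewrite -hdot_delta A_adj hdotC hdot_delta. Qed.

Lemma A_coord_le a p q : cn (a (delta q) p) <= opn a.
Proof.
rewrite -hdot_delta; apply: le_trans (cauchy_schwarz_hn _ _) _.
by rewrite hn_delta mulr1; apply: le_trans (opnP _ _) _; rewrite hn_delta mulr1.
Qed.

(** If all coefficients vanish, the adjoint kills every [delta p]; a coordinate of [a x] is the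
    inner product of [x] with such a value, so no expansion of [x] is needed. *)
Lemma A_neq0 a : a != 0 -> exists p q, a (delta q) p != 0.
Proof.
move=> a0; apply: contrapT => h; move/negP: a0; apply; apply/eqP.
apply: A_ext => x; apply: l2_ext => p.
rewrite -hdot_delta A_adj (_ : Astar a (delta p) = 0).
  by rewrite -[X in hdot x X](subrr 0) hdotBr subrr.
apply: l2_ext => q; apply/eqP/negPn/negP => pq; apply: h; exists p, q.
by rewrite A_coord conjC_eq0.
Qed.

Lemma hdot_suml (I : Type) (r : seq I) (P : pred I) (f : I -> l2) y :
  hdot (\sum_(i <- r | P i) f i) y = \sum_(i <- r | P i) hdot (f i) y.
Proof.
apply: (big_morph (fun x => hdot x y)) => [x z|]; first exact: hdotDl.
by rewrite -(scale0r 0) hdotZl mul0r.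
Qed.

Lemma hdot_sumr (I : Type) (r : seq I) (P : pred I) (f : I -> l2) y :
  hdot y (\sum_(i <- r | P i) f i) = \sum_(i <- r | P i) hdot y (f i).
Proof.
apply: (big_morph (hdot y)) => [x z|]; first exact: hdotDr.
by rewrite -(scale0r 0) hdotZr rmorph0 mul0r.
Qed.

Lemma A_sumE (I : Type) (r : seq I) (P : pred I) (f : I -> A) x :
  (\sum_(i <- r | P i) f i) x = \sum_(i <- r | P i) f i x.
Proof. exact: (big_morph (fun a : A => a x)). Qed.

Lemma l2_sumE (I : Type) (r : seq I) (P : pred I) (f : I -> l2) (p : G) :
  (\sum_(i <- r | P i) f i) p = \sum_(i <- r | P i) f i p.
Proof. exact: (big_morph (fun x : l2 => x p)). Qed.

Lemma A_sum (I : Type) (r : seq I) (P : pred I) (f : I -> l2) a :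
  a (\sum_(i <- r | P i) f i) = \sum_(i <- r | P i) a (f i).
Proof. by apply: (big_morph a); [exact: A_D|exact: A_0]. Qed.

Lemma real_complex_sum (I : Type) (r : seq I) (P : pred I) (f : I -> R) :
  (\sum_(i <- r | P i) f i)%:C = \sum_(i <- r | P i) (f i)%:C.
Proof. exact: rmorph_sum. Qed.

Section Compress.
Variables (S : splitting) (u v : S).

(** The matrix units; [eA s t] is $e_{st} \otimes 1$ for the factorization of l2(G) given by [S]. *)
Definition munit (s t : S) (i j : S) : C := ((i == s) && (j == t))%:R.
Definition eA s t : A := blockA (munit s t).

Lemma eAE s t x p : eA s t x p = if rho p == s then x (mv t p) else 0.
Proof.
rewrite blockAE block_opE (@sum_only _ _ t) => [|t' t't].
  by rewrite /munit eqxx andbT; case: ifP; rewrite ?mul1r ?mul0r.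
by rewrite /munit (negPf t't) andbF mul0r.
Qed.

Lemma eA_star s t : Astar (eA s t) = eA t s.
Proof.
rewrite [LHS]blockA_star; apply: A_ext => x; apply: l2_ext => p.
rewrite !blockAE !block_opE; apply: eq_bigr => i _; congr (_ * _).
by rewrite /madj /munit andbC; case: (_ && _); rewrite ?rmorph0 ?rmorph1.
Qed.

Lemma eA_mul s t i j x : eA s t (eA i j x) = if t == i then eA s j x else 0.
Proof.
apply: l2_ext => p; rewrite !eAE rho_mv mv_mv.
by case: (t =P i) => _; rewrite ?eAE; case: ifP.
Qed.

Lemma eA_sum x : \sum_t eA t t x = x.
Proof.
apply: l2_ext => p; rewrite l2_sumE (@sum_only _ _ (rho p)) => [|t tp].
  by rewrite eAE eqxx mv_rho.
by rewrite eAE eq_sym (negPf tp).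
Qed.

Lemma eA_bound : opn (eA u u) <= 1.
Proof.
have [e1|/ltW//] := leP 1 (opn (eA u u)).
have h := opn_sqr_le (eA u u).
have e : Amul (Astar (eA u u)) (eA u u) = eA u u.
  by apply: A_ext => x; rewrite AmulE eA_star eA_mul eqxx.
by rewrite e expr2 ger_pMr// in h; exact: lt_le_trans e1.
Qed.

(* Takes [blockA m] to the scalar [m u v] without increasing norms; ideals are
   stable under it, and this is where simplicity comes from. *)
Definition compress a : A := \sum_t smul (eA t u) (smul a (eA v t)).

Lemma compressE a x : compress a x = \sum_t eA t u (a (eA v t x)).
Proof. by rewrite A_sumE. Qed.

(** Pythagoras twice: the vectors [eA v t x] have squared norms adding up to that of [x], and the
    summands of [compress a x] for different [t] are orthogonal. *)
Lemma compress_bound a : opn (compress a) <= opn a.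
Proof.
apply: opn_min; split; first exact: opn_ge0.
move=> x; rewrite -(ler_pXn2r (_ : 0 < 2)%N) ?nnegrE ?mulr_ge0 ?hn_ge0
  ?opn_ge0//.
rewrite exprMn !hn_sqr.
have hsum : \sum_t hn2 (eA v t x) = hn2 x.
  apply: complexI; rewrite real_complex_sum -hdot_hn2.
  have -> : hdot x x = \sum_t hdot x (eA t t x) by rewrite -hdot_sumr eA_sum.
  by apply: eq_bigr => t _; rewrite -hdot_hn2 A_adj eA_star eA_mul eqxx.
have -> : hn2 (compress a x) = \sum_t hn2 (eA u u (a (eA v t x))).
  apply: complexI; rewrite real_complex_sum -hdot_hn2 compressE hdot_suml.
  apply: eq_bigr => t _; rewrite hdot_sumr (@sum_only _ _ t) => [|s st].
    by rewrite -hdot_hn2 !A_adj !eA_star !eA_mul !eqxx.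
  rewrite A_adj eA_star eA_mul eq_sym (negPf st).
  by rewrite -[X in hdot _ X](subrr 0) hdotBr subrr.
rewrite -hsum mulr_sumr; apply: ler_sum => t _.
rewrite -!hn_sqr -exprMn ler_pXn2r ?nnegrE ?mulr_ge0 ?hn_ge0 ?opn_ge0//.
apply: le_trans (opnP _ _) _; apply: le_trans (ler_wpM2r (hn_ge0 _) eA_bound) _.
by rewrite mul1r opnP.
Qed.

Lemma compressB a b : compress (a - b) = compress a - compress b.
Proof.
rewrite /compress -sumrB; apply: eq_bigr => t _.
by apply: A_ext => x; rewrite AB !smulE AB A_B.
Qed.

Lemma compress_blockA (m : S -> S -> C) : compress (blockA m) = m u v *: A1.
Proof.
apply: A_ext => x; apply: l2_ext => p; rewrite compressE l2_sumE AZ A1E l2Z.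
rewrite (@sum_only _ _ (rho p)) => [|t tp]; last first.
  by rewrite eAE eq_sym (negPf tp).
rewrite eAE eqxx blockAE block_opE rho_mv (@sum_only _ _ v) => [|t tv];
  last first.
  by rewrite eAE rho_mv (negPf tv) mulr0.
by rewrite eAE rho_mv eqxx !mv_mv mv_rho.
Qed.

End Compress.

(** A nonzero [b] in the ideal has a nonzero coefficient [d]. For ever finer blocks near [b], the
    element [compress b] stays in the ideal and approaches [d *: A1], so the closed ideal contains
    the unit. *)
Lemma ccr_simple : simple_cstar A.
Proof.
split.
  exists A1; apply/eqP => /(congr1 (fun a : A => a (delta 0) 0)).
  by rewrite A1E deltaE eqxx => /eqP; rewrite oner_eq0.
move=> I [I0 IZ IM Icl]; have [h|] := pselect (forall a, I a -> a = 0).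
  by left; apply/seteqP; split=> [a /h //|a ->].
move=> /existsNP[b /not_implyP[Ib /eqP b0]]; right.
suff I1 : I A1.
  by apply/seteqP; split=> // a _; rewrite -(smula1 a); exact: (IM a A1 I1).1.
have [p [q]] := A_neq0 b0; set d := b (delta q) p => d0.
suff : I (d *: A1).
  by move=> h; have := IZ d^-1 _ _ h I0; rewrite addr0 scalerA mulVf// scale1r.
have I_sum (J : finType) (f : J -> A) : (forall i, I (f i)) -> I (\sum_i f i).
  move=> If; elim/big_ind: _ => // x y Ix Iy.
  by rewrite -[x]scale1r; exact: IZ.
rewrite (closure_id I).1// => B; rewrite -nbhs_ballE.
move=> [_ /= /gt0_complexE[e e0 ->] eB].
have dp : 0 < cn d by rewrite -ltcR -cnE normr_gt0.
(* The bound [cn d / 2] forces [p] and [q] into one coset; the bound [e / 3] keeps the sum of two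
   errors below [e]. *)
pose k := Num.min (cn d / 2) (e / 3).
have k0 : 0 < k by rewrite lt_min !divr_gt0.
have [S [m bm]] := blockA_dense b k0.
have db : cn (d - blockA m (delta q) p) <= k.
  by rewrite -l2B -AB (le_trans (A_coord_le _ _ _)).
(* Block operators have zero coefficient between different cosets, which is too far from [d]. *)
have qp : q = mv (rho q : S) p.
  apply/eqP/negPn/negP => qp; move: db.
  rewrite blockAE block_opE big1 ?subr0 => [|t _].
    move=> dk; have : cn d <= cn d / 2 by rewrite (le_trans dk)// ge_min lexx.
    by rewrite leNgt ltr_pdivrMr// ltr_pMr// ltr1n.
  rewrite deltaE; case: eqP => [h|_]; last by rewrite mulr0.
  by move: qp; rewrite -h rho_mv eqxx.
have dm : blockA m (delta q) p = m (rho p) (rho q).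
  rewrite blockAE block_opE (@sum_only _ _ (rho q)) => [|t tq].
    by rewrite deltaE -qp eqxx mulr1.
  rewrite deltaE; case: eqP => [h|_]; last by rewrite mulr0.
  by move: tq; rewrite -h rho_mv eqxx.
exists (compress (rho p : S) (rho q) b); split.
  by apply: I_sum => t; apply: (IM _ _ _).1; exact: (IM _ _ Ib).2.
apply: eB; rewrite -ball_normE/= AnormE ltcR.
have -> : d *: A1 - compress (rho p : S) (rho q) b =
  (d - m (rho p) (rho q)) *: A1 -
    compress (rho p : S) (rho q) (b - blockA m).
  by rewrite compressB compress_blockA scalerBl opprB addrA subrK.
apply: (@le_lt_trans _ _ (k + k)); last first.
  apply: (@le_lt_trans _ _ (e / 3 + e / 3)).
    by rewrite lerD// ge_min lexx orbT.
  by lra.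
apply: le_trans (opnB _ _) _; apply: lerD.
  apply: (@le_trans _ _ (cn (d - m (rho p) (rho q)) * 1)).
    rewrite opnZ; apply: ler_wpM2l; first exact: cn_ge0.
    by apply: opn_min; split => // x; rewrite A1E mul1r.
  by rewrite mulr1 -dm.
by rewrite (le_trans (compress_bound _ _ _)).
Qed.

End Local.

(** * Nuclearity *)

Lemma sum_rank (V : nmodType) (I : finType) (F : 'I_#|I| -> V) :
  \sum_(a : I) F (enum_rank a) = \sum_i F i.
Proof. by rewrite [RHS](reindex enum_rank)//;
  exact: onW_bij (@enum_rank_bij I). Qed.

(** By the spectral theorem $P = U^*DU$ with $D \ge 0$, and $Y = D^{1/2}U$. An arbitrary finite
    index type allows pairs of indices, as block matrices need. *)
Lemma psd_factor (K : numClosedFieldType) (I : finType) (P : I -> I -> K) :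
  (forall a b, Num.conj (P a b) = P b a) ->
  (forall c : I -> K, 0 <= \sum_a \sum_b Num.conj (c a) * P a b * c b) ->
  exists Y : I -> I -> K, forall a b,
    P a b = \sum_d Num.conj (Y d a) * Y d b.
Proof.
move=> Pherm Ppos.
pose M : 'M[K]_#|I| := \matrix_(i, j) P (enum_val i) (enum_val j).
have ME a b : M (enum_rank a) (enum_rank b) = P a b by rewrite mxE !enum_rankK.
have Mherm : map_mx Num.conj M^T = M.
  by apply/matrixP => i j; rewrite !mxE Pherm.
have Mnormal : M \is normalmx by apply/normalmxP; rewrite Mherm.
pose U := spectralmx M; pose D := spectral_diag M.
have UU : U \is unitarymx := spectral_unitarymx M.
have Uunit : U \in unitmx := spectral_unit M.
have MUD : M = map_mx Num.conj U^T *m diag_mx D *m U.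
  by rewrite -invmx_unitary//; exact/orthomx_spectralP.
have DE : diag_mx D = U *m M *m map_mx Num.conj U^T.
  rewrite MUD -!mulmxA (unitarymxP UU) mulmx1 mulmxA.
  by rewrite (unitarymxP UU) mul1mx.
have D0 k : 0 <= D 0 k.
  have -> : D 0 k = diag_mx D k k by rewrite mxE eqxx mulr1n.
  rewrite DE mxE; have := Ppos (fun a => Num.conj (U k (enum_rank a))).
  congr (_ <= _); rewrite exchange_big/= -sum_rank.
  apply: eq_bigr => b _; rewrite !mxE mulr_suml -sum_rank.
  by apply: eq_bigr => a _; rewrite conjCK ME.
exists (fun d b => sqrtC (D 0 (enum_rank d)) * U (enum_rank d) (enum_rank b)).
move=> a b; rewrite -ME MUD mxE -sum_rank; apply: eq_bigr => d _.
have conjM (x y : K) : Num.conj (x * y) = Num.conj x * Num.conj y.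
  exact: rmorphM.
have cs k : Num.conj (sqrtC (D 0 k)) = sqrtC (D 0 k).
  by rewrite conj_Creal// ger0_real// sqrtC_ge0.
rewrite mul_mx_diag !mxE conjM cs mulrACA -expr2 sqrtCK.
by rewrite mulrCA mulrA.
Qed.

Section Nuclear.
Context {R : realType}.
Local Notation C := R[i].
Local Notation l2 := (l2 R).
Local Notation A := (ccr R).

Lemma sum_seq_le (r : seq G) (x : l2) : uniq r ->
  \sum_(p <- r) nsq (x p) <= hn2 x.
Proof.
move=> ur; rewrite -hn_sqr; apply: le_trans (part_le_hn x (seq_size r)).
have -> : \sum_(p <- r) nsq (x p) =
  \sum_(p <- Fn (seq_size r) | p \in r) nsq (x p).
  rewrite -[RHS]big_filter; apply: perm_big; apply: uniq_perm => // [|p].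
    by rewrite filter_uniq ?Fn_uniq.
  rewrite mem_filter; case: (boolP (p \in r)) => //= pr.
  by rewrite (seq_size_sub (leqnn _)).
rewrite [leRHS](bigID (mem r))/= lerDl; apply: sumr_ge0 => p _.
exact: nsq_ge0.
Qed.

Variable S : splitting.
Local Notation k := #|S|.

Definition smx (M : 'M[C]_k) (s t : S) : C := M (enum_rank s) (enum_rank t).

Lemma sum_iota (V : nmodType) (f : G -> V) :
  \sum_(p <- codom (@iota S)) f p = \sum_(t : S) f (iota t).
Proof. by rewrite /codom /image_mem big_map big_enum. Qed.

Lemma uniq_iota : uniq (codom (@iota S)).
Proof. by apply/injectiveP; exact: can_inj (@rhoK S). Qed.

(** The compression of [a] to the span of the point masses on the finite summand. It is a left
    inverse of the embedding [inject_mx], which sends $m$ to $m \otimes 1$. *)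
Definition corner_mx (a : A) : 'M[C]_k :=
  \matrix_(i, j) a (delta (iota (enum_val j))) (iota (enum_val i)).

Definition inject_mx (M : 'M[C]_k) : A := blockA (smx M).

Lemma smx_corner_mx a s t : smx (corner_mx a) s t = a (delta (iota t)) (iota s).
Proof. by rewrite /smx mxE !enum_rankK. Qed.

Lemma inject_mx_corner (m : S -> S -> C) :
  inject_mx (corner_mx (blockA m)) = blockA m.
Proof.
apply: A_ext => x; rewrite /inject_mx !blockAE; congr (block_op _ x).
apply/funext => s; apply/funext => t;
  rewrite smx_corner_mx blockAE block_opE rhoK.
rewrite (@sum_only _ _ t) => [|u ut].
  by rewrite mv_iota deltaE eqxx mulr1.
rewrite mv_iota deltaE (inj_eq (can_inj (@rhoK S))) (negPf ut) mulr0.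
by [].
Qed.

Definition vec (v : S -> C) : l2 :=
  fin_vec (codom (@iota S)) (fun p => v (rho p)).

Lemma hn2_vec v : hn2 (vec v) = \sum_t nsq (v t).
Proof.
by rewrite hn2_fin_vec ?uniq_iota// sum_iota; apply: eq_bigr => t _;
  rewrite rhoK.
Qed.

Lemma vecE v : vec v = \sum_t v t *: delta (iota t).
Proof.
apply: l2_ext => p; rewrite l2_sumE fin_vecE; case: ifPn => [/codomP[t ->]|pn].
  rewrite rhoK (@sum_only _ _ t) => [|u ut].
    by rewrite l2Z deltaE eqxx mulr1.
  by rewrite l2Z deltaE (inj_eq (can_inj (@rhoK S))) eq_sym (negPf ut) mulr0.
rewrite big1// => t _; rewrite l2Z deltaE; case: eqP => [pt|_];
  last by rewrite mulr0.
by move: pn; rewrite pt codom_f.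
Qed.

Lemma corner_mx_bound a : mbound (smx (corner_mx a)) (opn a).
Proof.
split; first exact: opn_ge0.
move=> v; rewrite -(hn2_vec v) -hn_sqr -exprMn.
apply: (@le_trans _ _ (hn (a (vec v)) ^+ 2)); last first.
  by rewrite ler_pXn2r ?nnegrE ?mulr_ge0 ?hn_ge0 ?opn_ge0// opnP.
rewrite hn_sqr; apply: le_trans (sum_seq_le _ uniq_iota); rewrite sum_iota.
apply: ler_sum => s _; rewrite vecE A_sum l2_sumE.
rewrite (eq_bigr (fun t => a (v t *: delta (iota t)) (iota s)))// => t _.
by rewrite smx_corner_mx A_Z l2Z mulrC.
Qed.

Lemma mbound_mx (M : 'M[C]_k) (c : R) :
  mbound (smx M) c <-> mxopnorm_le M c%:C.
Proof.
have key (v : 'cV[C]_k) : (\sum_i `|v i 0| ^+ 2 : C) =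
    (\sum_(s : S) nsq (v (enum_rank s) 0))%:C.
  rewrite -sum_rank real_complex_sum; apply: eq_bigr => s _; exact/esym/nsqE.
have key2 (v : 'cV[C]_k) s : (M *m v) (enum_rank s) 0 =
    \sum_t smx M s t * v (enum_rank t) 0.
  by rewrite mxE -sum_rank.
split=> -[c0 h]; split.
- by rewrite lecR.
- move=> v; rewrite !key -rmorphXn -rmorphM lecR.
  by under eq_bigr do rewrite key2; exact: (h (fun s => v (enum_rank s) 0)).
- by rewrite -lecR.
- move=> v; have := h (\col_i v (enum_val i)).
  rewrite !key -rmorphXn -rmorphM lecR.
  under eq_bigr do rewrite key2.
  under eq_bigr do under eq_bigr do rewrite mxE enum_rankK.
  by under [X in _ <= _ * X]eq_bigr do rewrite mxE enum_rankK.
Qed.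

Lemma corner_mx_linear : linear corner_mx.
Proof. by move=> c a b; apply/matrixP => i j; rewrite !mxE. Qed.

Lemma inject_mx_linear : linear inject_mx.
Proof.
move=> c M N; rewrite /inject_mx -blockA_comb; congr blockA.
by apply/funext => s; apply/funext => t; rewrite /smx !mxE.
Qed.

Lemma inject_mxM (M N : 'M[C]_k) :
  inject_mx (M *m N) = smul (inject_mx M) (inject_mx N).
Proof.
rewrite blockA_mul; congr blockA; apply/funext => s; apply/funext => t.
by rewrite /smx mxE -sum_rank.
Qed.

Lemma inject_mx_star (M : 'M[C]_k) : inject_mx (mxstar M) = star (inject_mx M).
Proof.
rewrite blockA_star; congr blockA; apply/funext => s; apply/funext => t.
by rewrite /smx /madj !mxE.
Qed.

(** A star-homomorphism, applied entrywise, sends $X^*X$ to $Y^*Y$ with $Y$ the image of $X$. *)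
Lemma inject_mx_cp : completely_positive inject_mx.
Proof.
split; first exact: inject_mx_linear.
have injD (M N : 'M[C]_k) : inject_mx (M + N) = inject_mx M + inject_mx N.
  by rewrite -[M in LHS]scale1r inject_mx_linear scale1r.
have inj0 : inject_mx 0 = 0 by apply: (addrI (inject_mx 0));
  rewrite -injD !addr0.
move=> n X; exists (map_mx inject_mx X); apply/matrixP => i j; rewrite !mxE.
rewrite (big_morph inject_mx injD inj0); apply: eq_bigr => l _.
by rewrite !mxE -inject_mx_star -inject_mxM.
Qed.

(** The image of $X^*X$ is a Gram matrix of vectors of l2, not yet of finite ones. It is positive of
    size $n|S|$, so [psd_factor] gives a root of that size, which is cut into $n \times n$
    blocks. *)
Lemma corner_mx_cp : completely_positive corner_mx.
Proof.
split; first exact: corner_mx_linear.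
move=> n X.
pose P (a b : 'I_n * S) : C := \sum_(l < n)
  hdot (X l b.1 (delta (iota b.2))) (X l a.1 (delta (iota a.2))).
have [||Y YP] := @psd_factor C ('I_n * S)%type P.
- move=> a b; rewrite rmorph_sum; apply: eq_bigr => l _.
  by rewrite [RHS]hdotC.
- move=> c; pose w l : l2 := \sum_a c a *: X l a.1 (delta (iota a.2)).
  have -> : \sum_a \sum_b Num.conj (c a) * P a b * c b =
    \sum_l hdot (w l) (w l).
    rewrite /P; under eq_bigr do under eq_bigr do rewrite mulr_sumr mulr_suml.
    under eq_bigr do rewrite exchange_big/=.
    rewrite exchange_big/=; apply: eq_bigr => l _.
    rewrite hdot_sumr; apply: eq_bigr => a _.
    rewrite hdot_suml; apply: eq_bigr => b _.
    by rewrite hdotZr hdotZl mulrA mulrAC.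
  by apply: sumr_ge0 => l _; rewrite hdot_hn2 lecR hn2_ge0.
exists (\matrix_(l, i) (\matrix_(u, s) Y (l, enum_val u) (i, enum_val s))).
apply/matrixP => i j; apply/matrixP => s t; rewrite !mxE.
rewrite A_sumE l2_sumE summxE.
transitivity (P (i, enum_val s) (j, enum_val t)).
  apply: eq_bigr => l _; rewrite smulE -hdot_delta.
  by rewrite [LHS]hdotC -A_adj -hdotC.
transitivity (\sum_(l < n) \sum_(u : S)
    Num.conj (Y (l, u) (i, enum_val s)) * Y (l, u) (j, enum_val t)).
  by rewrite YP pair_big; apply: eq_bigr => -[l u].
apply: eq_bigr => l _; rewrite !mxE -sum_rank; apply: eq_bigr => u _.
by rewrite !mxE enum_rankK.
Qed.

End Nuclear.

Lemma ccr_nuclear (R : realType) : nuclear (ccr R).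
Proof.
move=> F e e0; have e30 : 0 < e / 3 by rewrite divr_gt0.
have [S h] := blockA_dense_seq F e30.
have gb (M : 'M[R[i]]_#|S|) c : mxopnorm_le M c%:C -> opn (inject_mx M) <= c.
  move=> /mbound_mx Mc; apply: opn_min; split; first by case: Mc.
  by move=> x; rewrite blockAE block_op_bound.
have fb (a : ccr R) : mxopnorm_le (@corner_mx R S a) (opn a)%:C.
  by apply/mbound_mx; exact: corner_mx_bound.
exists #|S|, (@corner_mx R S), (@inject_mx R S); split.
- split; [exact: corner_mx_cp|exact: fb].
- split; first exact: inject_mx_cp.
  move=> M c Mc; have c0 : 0 <= c by case: Mc.
  have cE : c = (Re c)%:C by rewrite RRe_real// ger0_real.
  by rewrite cE in Mc *; rewrite AnormE lecR; exact: gb.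
- move=> a /h[m am]; rewrite AnormE ltcR.
  (* The composite fixes [blockA m], so only the small element [a - blockA m] contributes, once
     through the contractions and once directly. *)
  have -> : inject_mx (corner_mx S a) - a =
    inject_mx (corner_mx S (a - blockA m)) - (a - blockA m) :> ccr R.
    have nB (M N : 'M[R[i]]_#|S|) :
      inject_mx (M - N) = inject_mx M - inject_mx N.
      by rewrite -scaleN1r addrC inject_mx_linear scaleN1r addrC.
    have fB (b c : ccr R) : corner_mx S (b - c) = corner_mx S b - corner_mx S c.
      by rewrite -scaleN1r addrC corner_mx_linear scaleN1r addrC.
    by rewrite fB nB inject_mx_corner opprB addrA subrK.
  apply: (@le_lt_trans _ _ (e / 3 + e / 3)); last by lra.
  apply: le_trans (opnB _ _) _; apply: lerD => //.
  exact: le_trans (gb _ _ (fb _)) am.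
Qed.

Section States.
Context {R : realType}.
Local Notation C := R[i].
Local Notation l2 := (l2 R).
Local Notation A := (ccr R).
Local Notation A1 := (@A1 R).
Implicit Types (a b p q : A) (phi : A -> C).

Lemma cn0 : cn (0 : C) = 0. Proof. by rewrite /cn nsq0 sqrtr0. Qed.
Lemma cn1 : cn (1 : C) = 1. Proof. by rewrite /cn nsq1 sqrtr1. Qed.
Lemma cn_eq0 (c : C) : cn c <= 0 -> c = 0.
Proof.
by move=> c0; apply/eqP; rewrite -normr_le0 cnE lecR.
Qed.
Lemma cnD (c d : C) : cn (c + d) <= cn c + cn d.
Proof. by rewrite -lecR rmorphD/= -!cnE ler_normD. Qed.
Lemma cnN (c : C) : cn (- c) = cn c. Proof. by rewrite /cn nsqN. Qed.
Lemma cnM (c d : C) : cn (c * d) = cn c * cn d.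
Proof. by rewrite /cn nsqM sqrtrM ?nsq_ge0. Qed.
Lemma cn_real (r : R) : cn r%:C = `|r|.
Proof. by rewrite /cn nsqC sqrtr_sqr. Qed.
Lemma Re_le_cn (c : C) : Re c <= cn c.
Proof.
rewrite /cn (le_trans (ler_norm _))// -sqrtr_sqr ler_wsqrtr// lerDl.
exact: sqr_ge0.
Qed.

(** * Pure states *)

Section Functional.
Variables (phi : A -> C).
Hypothesis phiL : scalar phi.

Lemma functionalD a b : phi (a + b) = phi a + phi b.
Proof. by rewrite -[a in LHS]scale1r phiL mul1r. Qed.
Lemma functional0 : phi 0 = 0.
Proof. by apply: (addrI (phi 0)); rewrite -functionalD !addr0. Qed.
Lemma functionalZ c a : phi (c *: a) = c * phi a.
Proof. by rewrite -[c *: a]addr0 phiL functional0 addr0. Qed.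
Lemma functionalB a b : phi (a - b) = phi a - phi b.
Proof. by rewrite functionalD -scaleN1r functionalZ mulN1r. Qed.

Hypothesis phi_pos : forall a, 0 <= phi (smul (star a) a).

Lemma state_intro : (forall a, cn (phi a) <= opn a) -> phi A1 = 1 -> state phi.
Proof.
move=> phib phi1; split=> //; split=> [r [a a1 phia]|r].
  have -> : r = cn (phi a) by apply: complexI; rewrite -phia cnE.
  by apply: le_trans (phib a) _; rewrite -lecR -AnormE.
apply; exists A1; last by rewrite phi1 cnE cn1.
rewrite AnormE lecR; apply: opn_min; split=> // x.
by rewrite A1E mul1r.
Qed.

(* The quadratic form [c |-> phi ((a + c b)^* (a + c b))] is affine in [c] and
   nonnegative, hence constant. *)
Lemma null_vector b a : phi (smul (star b) b) = 0 ->
  phi (smul (star b) a) = 0 /\ phi (smul (star a) b) = 0.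
Proof.
move=> b0; pose al := phi (smul (star a) a).
pose z := phi (smul (star b) a); pose w := phi (smul (star a) b).
have h (c : C) : 0 <= al + Num.conj c * z + c * w.
  have := phi_pos (a + c *: b).
  rewrite starD starZ smulDl !smulDr !smulZl !smulZr !functionalD !functionalZ
    b0 !mulr0 addr0.
  by rewrite -/al -/z -/w addrAC.
have al0 : Im al = 0 by apply: ger0_Im; exact: phi_pos.
have im c := ger0_Im (h c).
have re c : 0 <= Re (al + Num.conj c * z + c * w).
  by have := h c; rewrite lecE => /andP[].
have lin (x y : R) : 0 <= x -> (forall r : R, 0 <= x + r * y) -> y = 0.
  move=> x0 H; apply/eqP/negPn/negP => y0.
  have := H (- (x + 1) / y); rewrite mulfVK//.
  by rewrite opprD addrA subrr add0r oppr_ge0 ler10.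
have x0 : 0 <= Re al by have := phi_pos a; rewrite lecE => /andP[].
have [cpx [cpxR cpxI]] : exists cpx : R -> R -> C,
    (forall r s, Re (cpx r s) = r) /\ (forall r s, Im (cpx r s) = s).
  by exists (@Complex R).
(* Real and imaginary multiples in the real part, then [c = 1] and [c = -i] in the imaginary part,
   give four linear equations for [z] and [w]. *)
have r1 : Re z + Re w = 0.
  apply: (lin _ _ x0) => r; have := re (cpx r 0).
  by congr (_ <= _); rewrite !CE !cpxR !cpxI; ring.
have r2 : Im z - Im w = 0.
  apply: (lin _ _ x0) => r; have := re (cpx 0 r).
  by congr (_ <= _); rewrite !CE !cpxR !cpxI; ring.
have i1 : Im z + Im w = 0.
  by have := im (cpx 1 0); rewrite !CE !cpxR !cpxI al0; lra.
have i2 : Re z - Re w = 0.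
  by have := im (cpx 0 (- 1)); rewrite !CE !cpxR !cpxI al0; lra.
have zE : z = 0 by apply: complex_ext; rewrite -[0]/(0%:C) !CE; lra.
have wE : w = 0 by apply: complex_ext; rewrite -[0]/(0%:C) !CE; lra.
by [].
Qed.

End Functional.

Lemma state_le phi a : state phi -> cn (phi a) <= opn a.
Proof.
move=> [phiL _ [ub _]].
have [a0|a0] := eqVneq (opn a) 0.
  by rewrite (opn_eq0 a0) (functional0 phiL) cn0 opn_ge0.
have ap : 0 < opn a by rewrite lt_neqAle eq_sym a0 opn_ge0.
have := ub (cn (phi (((opn a)^-1)%:C *: a))).
have nV : cn ((opn a)^-1)%:C = (opn a)^-1.
  by rewrite cn_real ger0_norm// invr_ge0 opn_ge0.
rewrite (functionalZ phiL) cnM nV -ler_pdivlMl ?invr_gt0// invrK mulr1; apply.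
exists (((opn a)^-1)%:C *: a); last by rewrite (functionalZ phiL) cnE cnM nV.
by rewrite AnormE opnZ nV mulVf.
Qed.

Lemma star1 : star A1 = A1.
Proof.
have : star (smul (star A1) A1) = smul (star A1) A1 by rewrite starM starK.
by rewrite smula1 starK.
Qed.

Lemma opn1 : opn A1 <= 1.
Proof. by apply: opn_min; split=> // x; rewrite A1E mul1r. Qed.

Lemma opn_proj p : star p = p -> smul p p = p -> opn p <= 1.
Proof.
move=> ps pp; have [p1|/ltW//] := leP 1 (opn p).
have := opn_sqr_le p; rewrite -[Amul _ _]/(smul (star p) p) ps pp.
by rewrite expr2 ger_pMr//; exact: lt_le_trans p1.
Qed.

Lemma state_dense phi psi : state phi -> state psi ->
  (forall (S : splitting) (m : S -> S -> C), phi (blockA m) = psi (blockA m)) ->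
    phi =1 psi.
Proof.
move=> sphi spsi e a; apply/eqP; rewrite -subr_eq0; apply/eqP/cn_eq0.
apply/ler_addgt0Pr => k k0; rewrite add0r.
have k20 : 0 < k / 2 by rewrite divr_gt0.
have [S [m am]] := blockA_dense a k20.
have [phiL _ _] := sphi; have [psiL _ _] := spsi.
have -> : phi a - psi a = phi (a - blockA m) - psi (a - blockA m).
  by rewrite (functionalB phiL) (functionalB psiL) e opprB addrA subrK.
apply: le_trans (cnD _ _) _; rewrite cnN [k]splitr.
by apply: lerD; apply: le_trans (state_le _ _) am.
Qed.

(* [phi] vanishes on the left ideal and on the right ideal generated by
   [A1 - p]. *)
Lemma state_proj phi p : state phi -> star p = p -> smul p p = p ->
  phi p = 1 -> forall a, phi a = phi (smul p (smul a p)).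
Proof.
move=> sphi ps pp p1 a; have [phiL phi_pos _] := sphi.
pose q := A1 - p.
have qs : star q = q.
  by rewrite /q starD star1 -scaleN1r starZ rmorphN1 ps.
have qq : smul q q = q.
  rewrite /q -scaleN1r smulDl !smulDr !smulZl !smulZr !smul1a !smula1 pp.
  by rewrite scalerA mulN1r opprK scale1r scaleN1r addNr addr0.
(* Here [q] equals its own square $q^*q$, so [phi q] is nonnegative; it is also at most 0, because
   [phi A1] is at most 1 and [phi p = 1]. *)
have q0 : phi (smul (star q) q) = 0.
  have h := phi_pos q; have h1 := phi_pos A1.
  have h2 := state_le A1 sphi.
  apply/eqP; rewrite eq_le h andbT.
  move: h1; rewrite star1 smul1a qs qq (functionalB phiL) p1 subr_le0 => h1.
  rewrite -[phi A1](RRe_real (ger0_real h1)) -[1]/(1%:C) lecR.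
  exact: le_trans (Re_le_cn _) (le_trans h2 opn1).
have ql b : phi (smul q b) = 0.
  by rewrite -qs; exact: (null_vector phiL phi_pos b q0).1.
have conjq b : phi (smul b q) = 0.
  by rewrite -[b]starK; exact: (null_vector phiL phi_pos (star b) q0).2.
have e : a = smul p (smul a p) + smul (smul p a) q + smul q a.
  have -> : smul (smul p a) q = smul p a - smul p (smul a p).
    by rewrite /q -scaleN1r smulDr smula1 smulZr scaleN1r smulA.
  have -> : smul q a = a - smul p a.
    by rewrite /q -scaleN1r smulDl smul1a smulZl scaleN1r.
  by rewrite [smul p (smul a p) + _]addrC subrK addrC subrK.
by rewrite {1}e !(functionalD phiL) ql conjq !addr0.
Qed.

End States.

Section Pure.
Context {R : realType}.
Local Notation C := R[i].
Local Notation l2 := (l2 R).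
Local Notation A := (ccr R).
Local Notation A1 := (@A1 R).
Implicit Types (a b p q : A) (phi : A -> C).

(** The number 1 is an extreme point of the unit interval. *)
Lemma convex_one (t : R) (c d : C) : 0 < t < 1 -> 0 <= c -> 0 <= d ->
  cn c <= 1 -> cn d <= 1 -> 1 = t%:C * c + (1 - t)%:C * d -> c = 1 /\ d = 1.
Proof.
move=> /andP[t0 t1] c0 d0 c1 d1 e.
have [r rc] : exists r : R, c = r%:C.
  by exists (Re c); rewrite RRe_real// ger0_real.
have [s sd] : exists s : R, d = s%:C.
  by exists (Re d); rewrite RRe_real// ger0_real.
have r1 : r <= 1 by apply: le_trans c1; rewrite rc -[leLHS]ReC Re_le_cn.
have s1 : s <= 1 by apply: le_trans d1; rewrite sd -[leLHS]ReC Re_le_cn.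
move: e; rewrite rc sd -!rmorphM -rmorphD => /complexI e.
suff [-> ->] : r = 1 /\ s = 1 by [].
by split; nra.
Qed.

(** By extremality of 1, both parts of a convex decomposition take the value 1 at [p]. By
    [state_proj] such a state sees only the compression by [p], which is the scalar
    [phi (blockA m)]; so it agrees with [phi] on blocks, hence everywhere. *)
Lemma pure_state_intro phi : state phi ->
  (forall (S : splitting) (m : S -> S -> C), exists p,
    [/\ star p = p, smul p p = p, phi p = 1
      & smul p (smul (blockA m) p) = phi (blockA m) *: p]) ->
  pure_state phi.
Proof.
move=> sphi H; split=> // phi1 phi2 t s1 s2 t01 e.
have key i : i = phi1 \/ i = phi2 -> i =1 phi.
  move=> ii; have si : state i by case: ii => ->.
  apply: state_dense => // S m; have [p [ps pp p1 pmp]] := H S m.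
  have ip : i p = 1.
    have pos (f : A -> C) : state f -> 0 <= f p.
      by move=> [_ fpos _]; rewrite -pp -{1}ps.
    have le1 (f : A -> C) : state f -> cn (f p) <= 1.
      by move=> sf; rewrite (le_trans (state_le _ sf))// opn_proj.
    have [h1 h2] := convex_one t01 (pos _ s1) (pos _ s2) (le1 _ s1) (le1 _ s2)
      (etrans (esym p1) (e p)).
    by case: ii => ->.
  rewrite (state_proj si ps pp ip) pmp.
  by have [iL _ _] := si; rewrite (functionalZ iL) ip mulr1.
by split; apply: key; [left|right].
Qed.

Lemma star_adj a (x y : l2) : hdot (star a x) y = hdot x (a y).
Proof. by rewrite (A_adj (star a)) -[Astar _]/(star (star a)) starK. Qed.

Definition point_state a : C := a (delta 0) 0.

Lemma hdot_ge0 (x : l2) : 0 <= hdot x x.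
Proof. by rewrite hdot_hn2 lecR hn2_ge0. Qed.

Lemma point_state_state : state point_state.
Proof.
apply: state_intro.
- by move=> c a b.
- move=> a; rewrite /point_state -hdot_delta smulE star_adj.
  exact: hdot_ge0.
- by move=> a; exact: A_coord_le.
- by rewrite /point_state A1E deltaE eqxx.
Qed.

Lemma point_state_pure : pure_state point_state.
Proof.
apply: pure_state_intro; first exact: point_state_state.
(* On blocks of [S] this state is the entry at [u], [u], so the diagonal matrix unit is the required
   projection. *)
move=> S m; pose u : S := rho 0; exists (eA u u); split.
- exact: eA_star.
- by apply: A_ext => x; rewrite smulE eA_mul eqxx.
- by rewrite /point_state eAE eqxx mv_rho deltaE eqxx.
apply: A_ext => x; apply: l2_ext => p; rewrite !smulE AZ l2Z !eAE.
case: (eqVneq (rho p) u) => [pu|_]; last by rewrite mulr0.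
rewrite blockAE block_opE rho_mv (@sum_only _ _ u) => [|t tu]; last first.
  by rewrite eAE rho_mv (negPf tu) mulr0.
rewrite eAE rho_mv eqxx !mv_mv; congr (_ * _).
rewrite /point_state blockAE block_opE (@sum_only _ _ u) => [|t tu].
  by rewrite mv_rho deltaE eqxx mulr1.
rewrite deltaE; case: eqP => [h|_]; last by rewrite mulr0.
by move: tu; rewrite -(rho_mv t 0) h eqxx.
Qed.

Definition ind_vec n : l2 := fin_vec (Fn n) (fun=> 1).
Definition Nn n : R := (size (Fn n))%:R.

Lemma Nn_gt0 n : 0 < Nn n.
Proof.
rewrite ltr0n; have : (0 : G) \in Fn n by rewrite mem_Fn size_poly0.
by case: (Fn n).
Qed.

Lemma sum_Fn1 (c : C) n : \sum_(p <- Fn n) c = (Nn n)%:C * c.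
Proof.
rewrite big_const_seq count_predT -[iter _ _ _]/(_) iter_addr_0.
by rewrite /Nn rmorph_nat mulr_natl.
Qed.

Lemma hn2_ind_vec n : hn2 (ind_vec n) = Nn n.
Proof.
rewrite hn2_fin_vec ?Fn_uniq//; apply: complexI; rewrite real_complex_sum.
by under eq_bigr do rewrite nsq1; rewrite sum_Fn1 mulr1.
Qed.

(** The vector state at the normalized indicator of [Fn n]. *)
Definition avg n a : C := ((Nn n)^-1)%:C * hdot (a (ind_vec n)) (ind_vec n).

Lemma avg_scalar n : scalar (avg n).
Proof.
by move=> c a b; rewrite /avg AD AZ hdotDl hdotZl mulrDr mulrCA.
Qed.

Lemma avg_le n a : cn (avg n a) <= opn a.
Proof.
have N0 := Nn_gt0 n.
rewrite /avg cnM cn_real ger0_norm ?invr_ge0 ?(ltW N0)// ler_pdivrMl//.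
apply: le_trans (cauchy_schwarz_hn _ _) _.
apply: le_trans (ler_wpM2r (hn_ge0 _) (opnP _ _)) _.
by rewrite -mulrA -expr2 hn_sqr hn2_ind_vec mulrC.
Qed.

Lemma avg_pos n a :
  avg n (smul (star a) a) = ((Nn n)^-1 * hn2 (a (ind_vec n)))%:C.
Proof. by rewrite /avg smulE star_adj hdot_hn2 rmorphM. Qed.

Definition mean (S : splitting) (m : S -> S -> C) : C :=
  (#|S|%:R)^-1 * \sum_s \sum_t m s t.

(** For these [n] the indicator of [Fn n] is constant on cosets, that is, uniform in the finite
    factor; so every coset contributes the same value and [n] cancels. *)
Lemma avg_blockA (S : splitting) (m : S -> S -> C) n : (split_size S <= n)%N ->
  avg n (blockA m) = mean m.
Proof.
move=> Sn; have S0 : (#|S|%:R : C) != 0 by rewrite pnatr_eq0 -lt0n card_gt0.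
have N0 : (Nn n)%:C != 0 :> C.
  by rewrite -[0]/(0%:C) (inj_eq (@complexI _)) gt_eqF// Nn_gt0.
rewrite /avg /mean fmorphV; apply: (mulfI N0); rewrite mulVKf//.
apply: (mulfI S0); rewrite [RHS]mulrCA mulVKf// mulr_natl.
rewrite hdot_fin_vec ?Fn_uniq// -(sum_mv _ Sn).
rewrite -sum_Fn1; apply: eq_big_seq => p pn; apply: eq_bigr => s _.
rewrite conjC1 mulr1 blockAE [LHS]block_fun_mv; apply: eq_bigr => t _.
have tn : mv t p \in Fn n.
  rewrite mem_Fn; apply: leq_trans (size_polyD _ _) _; rewrite geq_max.
  by rewrite -mem_Fn pn (leq_trans (size_iota _)).
by rewrite fin_vecE tn mulr1.
Qed.

(** The averages are contractive and eventually constant on the dense set of blocks, hence Cauchy on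
    every element. *)
Lemma avg_cvg a : exists z, clim (fun n => avg n a) z.
Proof.
have key (h : C -> R) : (forall c d : C, h (c - d) = h c - h d) ->
    (forall c : C, `|h c| <= cn c) ->
    exists l : R, h (avg n a) @[n --> \oo] --> l.
  move=> hB hle;
    suff /cvg_ex[l hl] : cvg (h (avg n a) @[n --> \oo]) by exists l.
  apply: R_complete; apply/cauchyP => e e0.
  have e20 : 0 < e / 2 by rewrite divr_gt0.
  have [S [m am]] := blockA_dense a e20; exists (h (mean m)).
  exists (split_size S) => // n /= Sn;
    rewrite -ball_normE/= -(avg_blockA m Sn) -hB.
  rewrite -(functionalB (avg_scalar n)) (le_lt_trans (hle _))//.
  apply: le_lt_trans (avg_le _ _) _; rewrite -opnN opprB.
  by apply: le_lt_trans am _; lra.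
have [x xP] := key (@Re R) ltac:(by move=> c d; rewrite !CE)
  ltac:(by move=> c; rewrite /cn -sqrtr_sqr ler_wsqrtr// lerDl sqr_ge0).
have [y yP] := key (@Im R) ltac:(by move=> c d; rewrite !CE)
  ltac:(by move=> c; rewrite /cn -sqrtr_sqr ler_wsqrtr// lerDr sqr_ge0).
by exists (x +i* y).
Qed.

Definition mean_state a : C := projT1 (cid (avg_cvg a)).

Lemma mean_stateP a : clim (fun n => avg n a) (mean_state a).
Proof. by rewrite /mean_state; case: cid. Qed.

Lemma mean_state_eq a z N : (forall n, (N <= n)%N -> avg n a = z) ->
  mean_state a = z.
Proof. by move=> h; apply: clim_unique (mean_stateP a) (clim_eventually h). Qed.

Lemma mean_state_state : state mean_state.
Proof.
apply: state_intro.
- move=> c a b; apply: clim_unique (mean_stateP _) _.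
  under eq_fun do rewrite avg_scalar.
  by apply: climD; [apply: climM|]; exact: mean_stateP.
- move=> a; have [reP imP] := mean_stateP (smul (star a) a).
  rewrite lecE; apply/andP; split.
    apply/eqP; apply: (cvg_unique _ imP) => //.
    by apply: cvg_near_cst; apply: nearW => n; rewrite avg_pos.
  apply: (cvgr_to_ge reP); apply: nearW => n; rewrite avg_pos ReC.
  by rewrite mulr_ge0 ?hn2_ge0// invr_ge0 ltW// Nn_gt0.
- move=> a; have [reP imP] := mean_stateP a.
  rewrite -(ler_pXn2r (_ : 0 < 2)%N) ?nnegrE ?cn_ge0 ?opn_ge0//.
  rewrite sqr_sqrtr ?nsq_ge0//.
  apply: (@cvgr_to_le _ \oo _ _ (fun n => nsq (avg n a))).
    apply: (@cvgD _ _ _ _ _ (fun n => Re (avg n a) ^+ 2)).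
      by apply: cvgM.
    by apply: cvgM.
  apply: nearW => n; rewrite -[leLHS]sqr_sqrtr ?nsq_ge0//.
  by rewrite ler_pXn2r ?nnegrE ?sqrtr_ge0 ?opn_ge0// avg_le.
- apply: (@mean_state_eq _ _ 0%N) => n _; rewrite /avg A1E hdot_hn2 hn2_ind_vec.
  by rewrite -rmorphM mulVf// gt_eqF// Nn_gt0.
Qed.

Lemma mean_state_blockA (S : splitting) (m : S -> S -> C) :
  mean_state (blockA m) = mean m.
Proof. by apply: (@mean_state_eq _ _ (split_size S)) => n;
  exact: avg_blockA. Qed.

Lemma mean_state_pure : pure_state mean_state.
Proof.
apply: pure_state_intro; first exact: mean_state_state.
move=> S m; pose k : C := (#|S|%:R)^-1.
have S0 : (#|S|%:R : C) != 0 by rewrite pnatr_eq0 -lt0n card_gt0.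
have sumk (c : C) : \sum_(s : S) c = #|S|%:R * c.
  by rewrite sumr_const mulr_natl.
(* The projection onto the constant vectors of the finite factor: all entries are $1/|S|$. *)
exists (blockA (fun _ _ : S => k)); split.
- rewrite blockA_star; congr blockA; apply/funext => s; apply/funext => t.
  by rewrite /madj /k fmorphV rmorph_nat.
- rewrite blockA_mul; congr blockA; apply/funext => s; apply/funext => t.
  by rewrite /mmul sumk /k mulrA mulfV// mul1r.
- by rewrite mean_state_blockA /mean !sumk mulKf// /k mulfV.
rewrite mean_state_blockA !blockA_mul; apply: A_ext => x; apply: l2_ext => p.
rewrite AZ l2Z !blockAE !block_opE mulr_sumr; apply: eq_bigr => t _.
rewrite mulrA; congr (_ * _); rewrite /mmul /mean -mulr_sumr -mulrA;
  congr (_ * _).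
by rewrite mulr_suml; apply: eq_bigr => s _; rewrite mulr_suml.
Qed.

End Pure.

(** * Separability and inhomogeneity *)

Section Final.
Context (R : realType).
Local Notation C := R[i].
Local Notation l2 := (l2 R).
Local Notation A := (ccr R).

Lemma A_continuous (a : A) : continuous (a : l2 -> l2).
Proof.
move=> x B /nbhs_ballP[_ /= /gt0_complexE[e e0 ->] eB].
have k0 : 0 < opn a + 1 by rewrite ltr_wpDl ?opn_ge0.
have d0 : 0 < (e / (opn a + 1))%:C :> C by rewrite ltcR divr_gt0.
apply/nbhs_ballP; exists (e / (opn a + 1))%:C => // y.
rewrite -ball_normE/= l2normE ltcR => xy.
apply: eB; rewrite -ball_normE/= -A_B l2normE ltcR (le_lt_trans (opnP _ _))//.
apply: (@le_lt_trans _ _ (opn a * (e / (opn a + 1)))).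
  by rewrite ler_wpM2l ?opn_ge0// ltW.
by rewrite mulrCA gtr_pMr// ltr_pdivrMr// mul1r ltrDl.
Qed.

Lemma ccr_faithful_rep : @faithful_representation R A l2 (fun a x => a x).
Proof.
split; last by move=> a b ab; apply: A_ext => x;
  exact: (congr1 (fun f : l2 -> l2 => f x) ab).
split=> //.
- by move=> a; split; [exact: A_linear|exact: A_continuous].
- by move=> a x y; rewrite -star_adj starK.
Qed.

Definition crat (z : rat * rat) : C := (ratr z.1 : R) +i* (ratr z.2 : R).

Lemma crat_dense (c : C) (e : R) : 0 < e -> exists z, cn (c - crat z) <= e.
Proof.
move=> e0; have rd (x : R) : exists q : rat, `|x - ratr q| <= e / 2.
  have [|q] := @rat_in_itvoo R (x - e / 2) (x + e / 2).
    by rewrite ltrD2l gtrN// divr_gt0.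
  rewrite in_itv/= => /andP[h1 h2]; exists q.
  by rewrite ler_norml; apply/andP; split; lra.
have [q1 h1] := rd (Re c); have [q2 h2] := rd (Im c).
exists (q1, q2); rewrite -(ler_pXn2r (_ : 0 < 2)%N) ?nnegrE ?cn_ge0 ?(ltW e0)//.
rewrite sqr_sqrtr ?nsq_ge0// /nsq !CE /=.
move: h1 h2; set u := Re c - _; set v := Im c - _.
rewrite !ler_norml => /andP[a1 a2] /andP[b1 b2].
by nra.
Qed.

Definition rat_vec (L : seq (G * (rat * rat))) : l2 :=
  \sum_(u <- L) crat u.2 *: delta u.1.

Lemma hn_sum (I : Type) (r : seq I) (f : I -> l2) :
  hn (\sum_(i <- r) f i) <= \sum_(i <- r) hn (f i).
Proof.
elim: r => [|i r IH]; first by rewrite !big_nil hn0.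
by rewrite !big_cons (le_trans (hnD _ _))// lerD2l.
Qed.

Lemma fin_vec_sum (r : seq G) (c : G -> C) : uniq r ->
  fin_vec r c = \sum_(p <- r) c p *: delta p.
Proof.
move=> ur; apply: l2_ext => q; rewrite l2_sumE fin_vecE.
rewrite [RHS](eq_bigr (fun p => if p == q then c p else 0)) => [|p _];
  last first.
  by rewrite l2Z deltaE eq_sym; case: eqP; rewrite ?mulr1 ?mulr0.
case: ifPn => qr.
  rewrite (big_rem q)//= eqxx big1_seq ?addr0// => p /andP[_].
  by rewrite mem_rem_uniq// inE => /andP[/negPf -> _].
rewrite big1_seq// => p /andP[_ pr].
by case: eqP => // pq; rewrite pq (negPf qr) in pr.
Qed.

Lemma rat_vec_dense (x : l2) (e : R) : 0 < e ->
  exists L, hn (x - rat_vec L) < e.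
Proof.
move=> e0; have e20 : 0 < e / 2 by rewrite divr_gt0.
have [n xn] : exists n, hn2 x - part n x < (e / 2) ^+ 2.
  have /cvgrPdist_lt/(_ _ (exprn_gt0 2 e20))[n _ h] := @part_cvg R x.
  exists n; apply: le_lt_trans (h n _); last exact: leqnn.
  exact: ler_norm.
(* Half of [e] pays for the truncation to [Fn n]; the other half is shared among its [Nn n]
   points. *)
pose d := e / 2 / (Nn n + 1).
have N0 : 0 < @Nn R n + 1 by rewrite addr_gt0// Nn_gt0.
have d0 : 0 < d by rewrite divr_gt0.
have /choice[z zP] : forall p, exists z, cn (x p - crat z) <= d.
  by move=> p; exact: crat_dense.
exists [seq (p, z p) | p <- Fn n].
rewrite /rat_vec (big_map (fun p => (p, z p)))/=.
apply: le_lt_trans (hn_tri _ (fin_vec (Fn n) x) _) _; rewrite [e]splitr.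
apply: ltr_leD.
  rewrite -(ltr_pXn2r (_ : 0 < 2)%N) ?nnegrE ?hn_ge0 ?(ltW e20)//.
  by rewrite hn_sqr hn2_trunc.
rewrite fin_vec_sum ?Fn_uniq// -sumrB; apply: le_trans (hn_sum _ _) _.
apply: (@le_trans _ _ (\sum_(p <- Fn n) d)).
  apply: ler_sum => p _; rewrite -scalerBl hnZ hn_delta mulr1; exact: zP.
rewrite big_const_seq count_predT iter_addr_0 -[leLHS]mulr_natl -/(@Nn R n).
rewrite /d mulrCA ger_pMr// ler_pdivrMr// mul1r.
by rewrite lerDl.
Qed.

Lemma l2_separable : separable_space l2.
Proof.
exists (range rat_vec); split;
  first exact: sub_countable (card_image_le rat_vec setT) (countableP _).
move=> O [x Ox] oO; have : nbhs x O by exact: open_nbhs_nbhs.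
move=> /nbhs_ballP[_ /= /gt0_complexE[e e0 ->] eO].
have [L xL] := rat_vec_dense x e0; exists (rat_vec L); split; last by exists L.
by apply: eO; rewrite -ball_normE/= l2normE ltcR.
Qed.

(** Polynomials have finite support, so an arbitrary subset [X] of the exponents defines a
    functional; this is the uncountable supply. *)
Definition chi (X : nat -> bool) (p : G) : 'F_2 :=
  \sum_(i < size (p : {poly 'F_2})) (X i)%:R * (p : {poly 'F_2})`_i.

Lemma chi_widen X (p : G) n : (size (p : {poly 'F_2}) <= n)%N ->
  chi X p = \sum_(i < n) (X i)%:R * (p : {poly 'F_2})`_i.
Proof.
move=> pn; rewrite /chi
  (big_ord_widen n (fun i => (X i)%:R * (p : {poly 'F_2})`_i))//.
rewrite [RHS](bigID (fun i : 'I_n => (i < size (p : {poly 'F_2}))%N))/=.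
rewrite [X in _ = _ + X]big1 ?addr0// => i; rewrite -leqNgt => pi.
by rewrite nth_default// mulr0.
Qed.

Lemma chiD X : {morph chi X : p q / p + q}.
Proof.
move=> p q; pose n := maxn (size (p : {poly 'F_2})) (size (q : {poly 'F_2})).
rewrite (@chi_widen X p n) ?leq_maxl// (@chi_widen X q n) ?leq_maxr//.
rewrite (@chi_widen X (p + q) n) ?size_polyD// -big_split/=.
by apply: eq_bigr => i _; rewrite -mulrDr -coefD.
Qed.

Lemma chiXn X i : chi X 'X^i = (X i)%:R.
Proof.
rewrite /chi size_polyXn big_ord_recr/= coefXn eqxx mulr1 big1 ?add0r// => j _.
by rewrite coefXn ltn_eqF ?mulr0.
Qed.

Definition sgn2 (c : 'F_2) : R := if c == 0 then 1 else -1.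

Lemma sgn2S (c : 'F_2) : sgn2 (c + 1) = - sgn2 c.
Proof. by case: (F2_case c) => ->; rewrite /sgn2/= ?opprK. Qed.

Lemma sgn2_sqr (c : 'F_2) : sgn2 c ^+ 2 = 1.
Proof. by rewrite /sgn2; case: ifP => _; rewrite ?sqrrN expr1n. Qed.

(** Since [chi X] factors through a splitting, multiplication by the character is exactly a diagonal
    block there, with no limit taken. *)
Lemma character_ex X :
  exists u : A, forall x p, u x p = (sgn2 (chi X p))%:C * x p.
Proof.
have [S _ hS] := extend_factors splitting0 (@chiD X).
exists (blockA
  (fun s t : S => if s == t then (sgn2 (chi X (iota s)))%:C else 0)).
move=> x p; rewrite blockAE block_opE (@sum_only _ _ (rho p)) => [|t tp].
  by rewrite eqxx hS mv_rho.
by rewrite eq_sym (negPf tp) mul0r.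
Qed.

Lemma mean_state_char X Y (u v : A) : X <> Y ->
  (forall x p, u x p = (sgn2 (chi X p))%:C * x p) ->
  (forall x p, v x p = (sgn2 (chi Y p))%:C * x p) ->
  mean_state (smul (star (u - v)) (u - v)) = 2.
Proof.
move=> XY uX vY; have [i Xi] : exists i, X i != Y i.
  apply: contrapT => h; apply: XY; apply/funext => i;
    apply/eqP/negPn/negP => hi.
  by apply: h; exists i.
(* From [i.+1] on, ['X^i] belongs to [Fn n], so translation by it permutes [Fn n]. *)
apply: (@mean_state_eq _ _ _ i.+1) => n ni; rewrite avg_pos.
have -> : (u - v) (ind_vec n) =
    fin_vec (Fn n) (fun p => (sgn2 (chi X p) - sgn2 (chi Y p))%:C).
  apply: l2_ext => p; rewrite AB l2B uX vY !fin_vecE -mulrBl.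
  by case: ifP => _; rewrite ?mulr0// mulr1 -rmorphB.
rewrite hn2_fin_vec ?Fn_uniq//; under eq_bigr do rewrite nsqC.
pose h p : R := (sgn2 (chi X p) - sgn2 (chi Y p)) ^+ 2.
(* Translation by ['X^i] flips exactly one of the two signs, as [X] and [Y] differ at [i]. So of the
   two terms one is 0 and the other 4, and the average of [h] is 2. *)
have hh (p : G) : h p + h (p + 'X^i) = 4.
  rewrite /h !chiD !chiXn.
  have := sgn2_sqr (chi X p); have := sgn2_sqr (chi Y p).
  move: Xi; case: (X i); case: (Y i) => //= _; rewrite ?addr0 ?sgn2S; nra.
have H : 2 * \sum_(p <- Fn n) h p = 4 * @Nn R n.
  have e : \sum_(p <- Fn n) h (p + 'X^i) = \sum_(p <- Fn n) h p.
    by apply: sumFn_shift; rewrite size_polyXn.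
  rewrite mulr_natl mulr2n -{2}e -big_split/=.
  under eq_bigr do rewrite hh.
  by rewrite big_const_seq count_predT iter_addr_0 /Nn mulr_natr.
have -> : \sum_(p <- Fn n) (sgn2 (chi X p) - sgn2 (chi Y p)) ^+ 2 =
  2 * @Nn R n by rewrite -[LHS]/(\sum_(p <- Fn n) h p); lra.
by rewrite mulrCA mulVf ?mulr1 ?rmorph_nat// gt_eqF// Nn_gt0.
Qed.

(** Applied to [delta 0], the images of the characters under [al] are vectors of l2 whose squared
    distances are values of [point_state] after [al], that is of [mean_state], hence 2. A separable
    space has no uncountable family of that kind. *)
Lemma ccr_not_homogeneous : ~ homogeneous_pure_states A.
Proof.
move=> /(_ _ _ (@point_state_pure R) (@mean_state_pure R))[al [aL aM aS _] ae].
have /choice[u uP] := character_ex.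
pose xi X : l2 := al (u X) (delta 0).
have alB a b : al (a - b) = al a - al b.
  by rewrite -scaleN1r addrC aL scaleN1r addrC.
have xi_dist X Y : X <> Y -> hn (xi X - xi Y) ^+ 2 = 2.
  move=> XY; apply: complexI; rewrite hn_sqr -hdot_hn2.
  have := mean_state_char XY (uP X) (uP Y); rewrite -ae /= aM aS alB.
  by rewrite /point_state -hdot_delta smulE star_adj AB => ->;
    rewrite rmorph_nat.
have [D [cD dD]] := l2_separable.
(* Two vectors [xi] within 1/2 of one point of [D] would have distance below 1, although its square
   is 2. *)
have half0 : 0 < (2^-1 : R)%:C :> C by rewrite ltcR invr_gt0.
have /choice[g gP] : forall X, exists d, D d /\ hn (xi X - d) < 2^-1.
  move=> X; have [||d [Bd Dd]] := dD (ball (xi X) (2^-1 : R)%:C).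
  - by exists (xi X); exact: ballxx.
  - exact: ball_open.
  by exists d; split => //; move: Bd; rewrite -ball_normE/= l2normE ltcR.
have ginj X Y : g X = g Y -> X = Y.
  move=> gXY; apply: contrapT => /xi_dist.
  have [_ h1] := gP X; have [_ h2] := gP Y.
  have h3 := hn_tri (xi X) (g X) (xi Y).
  have {}h2 : hn (g X - xi Y) < 2^-1 by rewrite gXY hnB.
  have h4 : hn (xi X - xi Y) < 1.
    by apply: le_lt_trans h3 _; rewrite [1]splitr div1r ltrD.
  have := hn_ge0 (xi X - xi Y); move: (hn _) h4 => y h4 y0 y2.
  by have : y ^+ 2 < 1 by [rewrite expr_lt1]; rewrite y2 ltrn1.
have /countable_injP[f fP] := cD.
(* Cantor's diagonal argument against the injection of all [X] into the naturals by [f (g X)]: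
   either value of [Z] at its own code is contradictory. *)
pose Z n := `[< exists X, f (g X) = n /\ X n = false >].
have fgZ : f (g Z) = f (g Z) by [].
case: (boolP (Z (f (g Z)))) =>
  [/[dup] ZZ /asboolP[X [fX Xn]]|/[dup] ZZ /asboolPn].
  have XZ : X = Z.
    by apply: ginj; apply: fP => //; rewrite inE; [case: (gP X)|case: (gP Z)].
  by rewrite XZ ZZ in Xn.
by apply; exists Z; split => //; exact: negbTE.
Qed.

End Final.

Theorem corollary2 (R : realType) :
  exists A : cstarAlgType R,
    [/\ simple_cstar A,
        nuclear A,
        ~ homogeneous_pure_states A
      & exists (H : hilbertType R) (pi : A -> H -> H),
          separable_space H /\ faithful_representation pi].
Proof.
exists (ccr R : cstarAlgType R); split.
- exact: ccr_simple.
- exact: ccr_nuclear.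
- exact: ccr_not_homogeneous.
- exists (l2 R : hilbertType R), (fun (a : ccr R) (x : l2 R) => a x); split.
    exact: l2_separable.
  exact: ccr_faithful_rep.
Qed.
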